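(* Let $\mathbb{K}$ be a field of characteristic $0$, $m \in \mathbb{Z}_{>0}$, $(d_1,\ldots,d_m)\in \mathbb{Z}_{>0}^m$, and let $\Omega\colon \mathbb{Z}^m\times\mathbb{Z}^m\to\mathbb{K}$ be a skewsymmetric additive bicharacter. Then every unipotent bi-integral automorphism $\phi$ of the Poisson function field $(\mathbb{K}(T),\{.,.\}_\Omega)$ satisfies $$\phi(y_k)\,y_k^{-1}\in \mathcal{Z}(\mathbb{K}[T]),\qquad \forall\, k\in\{1,\ldots,m\}.$$
   Context: $T$ is an $m$-dimensional torus over $\mathbb{K}$ with coordinate ring $\mathbb{K}[T]=\mathbb{K}[y_1^{\pm1},\ldots,y_m^{\pm1}]$ and rational function field $\mathbb{K}(T)=\mathbb{K}(y_1,\ldots,y_m)$. For $\alpha=(i_1,\ldots,i_m)\in\mathbb{Z}^m$ put $y^\alpha=y_1^{i_1}\cdots y_m^{i_m}$. A skewsymmetric additive bicharacter is a biadditive map $\Omega$ with $\Omega(\alpha,\beta)=-\Omega(\beta,\alpha)$. The Poisson bracket $\{.,.\}_\Omega$ on $\mathbb{K}[T]$ is given by $\{y^\alpha,y^\beta\}_\Omega=\Omega(\alpha,\beta)y^\alpha y^\beta$ for all $\alpha,\beta\in\mathbb{Z}^m$, and it is extended canonically to $\mathbb{K}(T)$. $\mathcal{Z}(\mathbb{K}[T])=\{z\in\mathbb{K}[T]\mid \{z,f\}_\Omega=0\ \forall f\in\mathbb{K}[T]\}$ is the Poisson center. $\mathbb{K}[T]$ is $\mathbb{Z}$-graded by $\deg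 y_k=d_k$, with graded components $\mathbb{K}[T]_n$; $\mathbb{K}[T]_{>n}=\bigoplus_{l>n}\mathbb{K}[T]_l$. An automorphism $\phi$ of the Poisson field $(\mathbb{K}(T),\{.,.\}_\Omega)$ (a $\mathbb{K}$-algebra automorphism preserving the bracket) is called bi-integral if $\phi(y_k),\phi^{-1}(y_k)\in\mathbb{K}[T]$ for all $k\in\{1,\ldots,m\}$. A bi-integral automorphism is called unipotent if $\phi(y_k)-y_k\in\mathbb{K}[T]_{>d_k}$ for all $k$. *)

(* Defs.v *)
From HB Require Import structures.
From mathcomp Require Import all_boot all_order all_algebra.
From mathcomp Require Import fraction mpoly ring.

Set Implicit Arguments.
Unset Strict Implicit.
Unset Printing Implicit Defensive.

Import Order.TTheory GRing.Theory Num.Theory.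
Local Open Scope ring_scope.

Notation torus_field K m := {fraction {mpoly K[m]}}.

Definition cst (K : fieldType) (m : nat) (c : K) : torus_field K m :=
  tofrac c%:MP.
Arguments cst {K} m c.

Definition yvar (K : fieldType) (m : nat) (k : 'I_m) : torus_field K m :=
  tofrac 'X_k.
Arguments yvar K {m} k.

Definition ymonom (K : fieldType) (m : nat) (alpha : 'rV[int]_m) :
    torus_field K m :=
  \prod_(k < m) yvar K k ^ alpha 0 k.
Arguments ymonom K {m} alpha.

Definition span_monoms (K : fieldType) (m : nat) (P : pred 'rV[int]_m)
    (f : torus_field K m) : Prop :=
  exists2 s : seq (K * 'rV[int]_m),
    all (fun t => P t.2) s
    & f = \sum_(t <- s) cst m t.1 * ymonom K t.2.

(* K[T] is not a type here but the subset of K(T) spanned by the y^alpha. *)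
Definition coord_ring (K : fieldType) (m : nat) (f : torus_field K m) : Prop :=
  span_monoms predT f.

Definition mdegree (m : nat) (d : 'I_m -> int) (alpha : 'rV[int]_m) : int :=
  \sum_(k < m) d k * alpha 0 k.

Definition graded_component (K : fieldType) (m : nat) (d : 'I_m -> int)
    (n : int) (f : torus_field K m) : Prop :=
  span_monoms (fun alpha => mdegree d alpha == n) f.

(* The sum of the components of degree l > n; it is direct because distinct
   Laurent monomials are linearly independent. *)
Definition graded_gt (K : fieldType) (m : nat) (d : 'I_m -> int)
    (n : int) (f : torus_field K m) : Prop :=
  exists (s : seq int) (g : int -> torus_field K m),
    (forall l, l \in s -> n < l /\ graded_component d l (g l))
    /\ f = \sum_(l <- s) g l.

Record skew_bicharacter (K : fieldType) (m : nat)
    (Omega : 'rV[int]_m -> 'rV[int]_m -> K) : Prop := {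
  bichar_addl : forall a b c, Omega (a + b) c = Omega a c + Omega b c;
  bichar_addr : forall a b c, Omega a (b + c) = Omega a b + Omega a c;
  bichar_skew : forall a b, Omega a b = - Omega b a }.

Record poisson_bracket (K : fieldType) (m : nat)
    (br : torus_field K m -> torus_field K m -> torus_field K m) : Prop := {
  pb_linear : forall c f g h,
    br (cst m c * f + g) h = cst m c * br f h + br g h;
  pb_skew : forall f g, br f g = - br g f;
  pb_leibniz : forall f g h, br f (g * h) = br f g * h + g * br f h;
  pb_jacobi : forall f g h,
    br f (br g h) + br g (br h f) + br h (br f g) = 0 }.

(* br is {.,.}_Omega on K(T).  The restriction of br to K[T] is determined by
   bilinearity, and its extension to fractions by the Leibniz rule:
   omega_bracket_exists and omega_bracket_unique below. *)
Definition omega_bracket (K : fieldType) (m : nat)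
    (Omega : 'rV[int]_m -> 'rV[int]_m -> K)
    (br : torus_field K m -> torus_field K m -> torus_field K m) : Prop :=
  poisson_bracket br /\
  forall a b, br (ymonom K a) (ymonom K b)
              = cst m (Omega a b) * ymonom K a * ymonom K b.

Definition poisson_center (K : fieldType) (m : nat)
    (br : torus_field K m -> torus_field K m -> torus_field K m)
    (z : torus_field K m) : Prop :=
  coord_ring z /\ forall f, coord_ring f -> br z f = 0.

(* The inverse psi is carried along because bi-integrality refers to it. *)
Record poisson_automorphism (K : fieldType) (m : nat)
    (br : torus_field K m -> torus_field K m -> torus_field K m)
    (phi : {rmorphism torus_field K m -> torus_field K m})
    (psi : torus_field K m -> torus_field K m) : Prop := {
  pa_cancel : cancel phi psi;
  pa_cancelV : cancel psi phi;
  pa_cst : forall c, phi (cst m c) = cst m c;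
  pa_bracket : forall f g, phi (br f g) = br (phi f) (phi g) }.

Definition bi_integral (K : fieldType) (m : nat)
    (phi psi : torus_field K m -> torus_field K m) : Prop :=
  forall k, coord_ring (phi (yvar K k)) /\ coord_ring (psi (yvar K k)).

Definition unipotent (K : fieldType) (m : nat) (d : 'I_m -> int)
    (phi : torus_field K m -> torus_field K m) : Prop :=
  forall k, graded_gt d (d k) (phi (yvar K k) - yvar K k).

Record derivation (F : fieldType) (D : F -> F) : Prop := {
  der_add : forall f g, D (f + g) = D f + D g;
  der_mul : forall f g, D (f * g) = D f * g + f * D g }.

Lemma der0 (F : fieldType) (D : F -> F) : derivation D -> D 0 = 0.
Proof.
move=> dD; have := der_add dD 0 0.
by rewrite addr0 => /eqP; rewrite -subr_eq subrr eq_sym => /eqP.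
Qed.

Lemma der1 (F : fieldType) (D : F -> F) : derivation D -> D 1 = 0.
Proof.
move=> dD; have := der_mul dD 1 1.
by rewrite !mulr1 mul1r => /eqP; rewrite -subr_eq subrr eq_sym => /eqP.
Qed.

Lemma der_sum (F : fieldType) (D : F -> F) (I : Type) (r : seq I) (f : I -> F) :
  derivation D -> D (\sum_(i <- r) f i) = \sum_(i <- r) D (f i).
Proof. by move=> dD; apply: (big_morph D (der_add dD) (der0 dD)). Qed.

Lemma der_inv (F : fieldType) (D : F -> F) f :
  derivation D -> f != 0 -> D f^-1 = - (D f / f ^+ 2).
Proof.
move=> dD f0; have := der_mul dD f f^-1.
rewrite divff // (der1 dD) => /esym/eqP; rewrite addrC addr_eq0 => /eqP e.
by apply: (mulfI f0); rewrite e; field; rewrite f0.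
Qed.

Lemma der_expn (F : fieldType) (D : F -> F) f n :
  derivation D -> D (f ^+ n) * f = n%:R * f ^+ n * D f.
Proof.
move=> dD; elim: n => [|n IHn]; first by rewrite expr0 (der1 dD) !mul0r.
rewrite exprS (der_mul dD) mulrDl -[f * _ * f]mulrA IHn -natr1.
by ring.
Qed.

Lemma der_expz (F : fieldType) (D : F -> F) f (z : int) :
  derivation D -> f != 0 -> D (f ^ z) = z%:~R * f ^ z * (D f / f).
Proof.
move=> dD f0.
have P n : D (f ^+ n) = n%:R * f ^+ n * (D f / f).
  by apply: (mulIf f0); rewrite (der_expn _ _ dD); field; rewrite f0.
case: z => n; first exact: P.
rewrite NegzE -exprnN exprnN -invr_expz (der_inv dD) ?expf_neq0 // P mulrNz.
rewrite -pmulrn -exprnP; set N : F := n.+1%:R; set x := f ^+ _.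
have x0 : x != 0 by rewrite expf_neq0.
by field; rewrite f0 x0.
Qed.

Lemma der_prod (F : fieldType) (D : F -> F) (m : nat) (y : 'I_m -> F)
    (a : 'I_m -> int) :
  derivation D -> (forall k, y k != 0) ->
  D (\prod_(k < m) y k ^ a k)
  = \prod_(k < m) y k ^ a k * \sum_(k < m) (a k)%:~R * (D (y k) / y k).
Proof.
move=> dD y0.
elim: (index_enum 'I_m) => [|k s IH]; first by rewrite !big_nil (der1 dD) mulr0.
rewrite !big_cons (der_mul dD) IH (der_expz _ dD) //.
set P := \prod_(j <- s) _; set S := \sum_(j <- s) _; set u := y k ^ _.
by set c := _%:~R; ring.
Qed.

Lemma cyclic_derivation (F : fieldType) (br : F -> F -> F) :
  (forall f g, br f g = - br g f) -> (forall f, derivation (br f)) ->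
  forall f g, derivation (fun h => br f (br g h) + br g (br h f) + br h (br f g)).
Proof.
move=> sk dbr f g.
have D u v w : br u (v + w) = br u v + br u w := der_add (dbr u) v w.
have Dl u v w : br (v + w) u = br v u + br w u.
  by rewrite sk D opprD -!sk.
have M u v w : br u (v * w) = br u v * w + v * br u w := der_mul (dbr u) v w.
have Ml u v w : br (v * w) u = br v u * w + v * br w u.
  by rewrite sk M opprD -mulNr -mulrN -!sk.
split=> u v; first by rewrite !(Dl, D); ring.
rewrite !(M, Ml, D) (sk u f) (sk v f).
have N x y : br x (- y) = - br x y.
  by apply/eqP; rewrite -addr_eq0 -D addNr (der0 (dbr x)).
by rewrite !N; ring.
Qed.

Lemma mulF_pi (R : idomainType) (x : {fraction R}) :
  x = tofrac (\n_(repr x)) / tofrac (\d_(repr x)).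
Proof.
have dn0 := denom_ratioP (repr x).
rewrite -{1}[x]reprK -{1}[repr x]Ratio_numden; move: dn0.
move: (\n_(repr x)) (\d_(repr x)) => p q q0.
unlock FracField.tofrac.
rewrite -[X in _ = _ * X]FracField.pi_inv -[RHS]FracField.pi_mul.
by rewrite /FracField.mulf /FracField.invf /= !numden_Ratio
  ?(oner_neq0, mul1r, mulr1).
Qed.

Definition fder_formula (F : fieldType) (p q dp dq : F) : F :=
  dp / q - p * dq / q ^+ 2.

Lemma fder_formula_eq (F : fieldType) (n d p q n' d' p' q' : F) :
  d != 0 -> q != 0 -> n * q = p * d -> n' * q + n * q' = p' * d + p * d' ->
  fder_formula n d n' d' = fder_formula p q p' q'.
Proof.
move=> d0 q0 e1 e2; rewrite /fder_formula.
have -> : n' = (p' * d + p * d' - n * q') / q.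
  by rewrite -e2 addrK mulfK.
have -> : n = p * d / q by rewrite -e1 mulfK.
by field; rewrite d0 q0.
Qed.

Lemma fder_formula_add (F : fieldType) (p q r s p' q' r' s' : F) :
  q != 0 -> s != 0 ->
  fder_formula (p * s + r * q) (q * s)
    (p' * s + p * s' + (r' * q + r * q')) (q' * s + q * s')
  = fder_formula p q p' q' + fder_formula r s r' s'.
Proof. by move=> q0 s0; rewrite /fder_formula; field; rewrite q0 s0. Qed.

Lemma fder_formula_mul (F : fieldType) (p q r s p' q' r' s' : F) :
  q != 0 -> s != 0 ->
  fder_formula (p * r) (q * s) (p' * r + p * r') (q' * s + q * s')
  = fder_formula p q p' q' * (r / s) + p / q * fder_formula r s r' s'.
Proof. by move=> q0 s0; rewrite /fder_formula; field; rewrite q0 s0. Qed.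

Definition fder (R : idomainType) (D : R -> R) (x : {fraction R}) :=
  fder_formula (tofrac \n_(repr x)) (tofrac \d_(repr x))
    (tofrac (D \n_(repr x))) (tofrac (D \d_(repr x))).

Lemma fderE (R : idomainType) (D : R -> R) (p q : R) :
  (forall a b, D (a * b) = D a * b + a * D b) -> q != 0 ->
  fder D (tofrac p / tofrac q) =
  fder_formula (tofrac p) (tofrac q) (tofrac (D p)) (tofrac (D q)).
Proof.
move=> DM q0; rewrite /fder.
have := mulF_pi (tofrac p / tofrac q); set x := _ / _.
have := denom_ratioP (repr x).
move: (\n_(repr x)) (\d_(repr x)) => n d d0 xE.
have qF : tofrac q != 0 by rewrite tofrac_eq0.
have dF : tofrac d != 0 by rewrite tofrac_eq0.
have e : n * q = p * d.
  apply/eqP; rewrite -tofrac_eq !rmorphM /=; apply/eqP.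
  by rewrite -[tofrac p](divfK qF) -/x xE [RHS]mulrAC divfK.
apply: fder_formula_eq => //; rewrite -!rmorphM //=; first by rewrite e.
by rewrite -!rmorphD /= -!DM e.
Qed.

Lemma fder_tofrac (R : idomainType) (D : R -> R) (p : R) :
  (forall a b, D (a * b) = D a * b + a * D b) ->
  fder D (tofrac p) = tofrac (D p).
Proof.
move=> DM; have D1 : D 1 = 0.
  have := DM 1 1; rewrite !mulr1 mul1r => /eqP.
  by rewrite -subr_eq subrr eq_sym => /eqP.
rewrite -[tofrac p]divr1 -tofrac1 (fderE _ DM (oner_neq0 R)) /fder_formula D1.
by rewrite tofrac1 tofrac0 mulr0 mul0r subr0 divr1.
Qed.

Lemma fder_derivation (R : idomainType) (D : R -> R) :
  (forall a b, D (a + b) = D a + D b) ->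
  (forall a b, D (a * b) = D a * b + a * D b) -> derivation (fder D).
Proof.
move=> DD DM.
have num2 (x y : {fraction R}) : exists p q r s,
    [/\ q != 0, s != 0, x = tofrac p / tofrac q & y = tofrac r / tofrac s].
  exists (\n_(repr x)), (\d_(repr x)), (\n_(repr y)), (\d_(repr y)).
  by split; rewrite ?denom_ratioP -?mulF_pi.
split=> [x y|x y].
- have [p [q [r [s [q0 s0 -> ->]]]]] := num2 x y.
  have qF : tofrac q != 0 by rewrite tofrac_eq0.
  have sF : tofrac s != 0 by rewrite tofrac_eq0.
  have -> : tofrac p / tofrac q + tofrac r / tofrac s
          = tofrac (p * s + r * q) / tofrac (q * s).
    by rewrite tofracD (tofracM p) (tofracM r) (tofracM q); apply: addf_div.
  rewrite (fderE _ DM (mulf_neq0 q0 s0)) (fderE _ DM q0) (fderE _ DM s0).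
  by rewrite DD !DM !tofracD !tofracM; apply: fder_formula_add.
have [p [q [r [s [q0 s0 -> ->]]]]] := num2 x y.
have qF : tofrac q != 0 by rewrite tofrac_eq0.
have sF : tofrac s != 0 by rewrite tofrac_eq0.
have -> : tofrac p / tofrac q * (tofrac r / tofrac s)
        = tofrac (p * r) / tofrac (q * s).
  by rewrite (tofracM p) (tofracM q); apply: mulf_div.
rewrite (fderE _ DM (mulf_neq0 q0 s0)) (fderE _ DM q0) (fderE _ DM s0).
by rewrite !DM !tofracD !tofracM; apply: fder_formula_mul.
Qed.

Lemma cstD (K : fieldType) (m : nat) (a b : K) :
  cst m (a + b) = cst m a + cst m b.
Proof. by rewrite /cst mpolyCD tofracD. Qed.

Lemma cstM (K : fieldType) (m : nat) (a b : K) :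
  cst m (a * b) = cst m a * cst m b.
Proof. by rewrite /cst mpolyCM tofracM. Qed.

Lemma cstN (K : fieldType) (m : nat) (a : K) : cst m (- a) = - cst m a.
Proof. by rewrite /cst mpolyCN tofracN. Qed.

Lemma cst1 (K : fieldType) (m : nat) : cst m (1 : K) = 1.
Proof. by rewrite /cst mpolyC1 tofrac1. Qed.

Lemma cst0 (K : fieldType) (m : nat) : cst m (0 : K) = 0.
Proof. by rewrite /cst mpolyC0 tofrac0. Qed.

Lemma cst_int (K : fieldType) (m : nat) (z : int) : cst m (z%:~R : K) = z%:~R.
Proof.
have cn n : cst m (n%:R : K) = n%:R.
  by elim: n => [|n IHn]; [exact: cst0 | rewrite -!natr1 cstD IHn cst1].
by case: z => n; rewrite ?NegzE ?mulrNz ?cstN -!pmulrn cn.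
Qed.

Lemma cst_sum (K : fieldType) (m : nat) (I : Type) (r : seq I) (f : I -> K) :
  cst m (\sum_(i <- r) f i) = \sum_(i <- r) cst m (f i).
Proof. exact: (big_morph _ (@cstD K m) (cst0 K m)). Qed.

Lemma yvar_neq0 (K : fieldType) (m : nat) (k : 'I_m) : yvar K k != 0.
Proof.
rewrite /coord tofrac_eq0; apply/eqP => /(congr1 (mcoeff U_(k)%MM)).
by rewrite mcoeff0 mcoeffX eqxx => /eqP; rewrite oner_eq0.
Qed.

Lemma monom_delta (K : fieldType) (m : nat) (k : 'I_m) :
  ymonom K (delta_mx 0 k) = yvar K k.
Proof.
rewrite /ymonom (bigD1 k) //= mxE !eqxx expr1z big1 ?mulr1 // => i ik.
by rewrite mxE (negPf ik) andbF expr0z.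
Qed.

Lemma der_cstM (K : fieldType) (m : nat) (D : torus_field K m -> _) c f :
  derivation D -> D (cst m c) = 0 -> D (cst m c * f) = cst m c * D f.
Proof. by move=> dD Dc; rewrite (der_mul dD) Dc mul0r add0r. Qed.

Lemma der_eq0 (K : fieldType) (m : nat) (D : torus_field K m -> _) :
  derivation D -> (forall c, D (cst m c) = 0) ->
  (forall k, D (yvar K k) = 0) -> forall f, D f = 0.
Proof.
move=> dD Dc Dk.
have DX (i : 'I_m) n : D (yvar K i ^+ n) = 0.
  apply: (mulIf (yvar_neq0 K i)).
  by rewrite (der_expn _ _ dD) Dk mulr0 mul0r.
have Dp (p : {mpoly K[m]}) : D (tofrac p) = 0.
  rewrite [p]mpolyE rmorph_sum /= (der_sum _ _ dD) big1_seq //= => x _.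
  rewrite -mul_mpolyC tofracM -/(cst m _) (der_cstM _ dD) // mpolyXE_id.
  rewrite rmorph_prod /=; apply/eqP; rewrite mulf_eq0; apply/orP; right.
  apply/eqP; elim: (index_enum 'I_m) => [|k s IH].
    by rewrite big_nil (der1 dD).
  rewrite big_cons (der_mul dD) IH tofracXn -/(yvar K k) DX.
  by rewrite mul0r mulr0 addr0.
move=> f; rewrite (mulF_pi f) (der_mul dD) Dp mul0r add0r.
by rewrite (der_inv dD) ?tofrac_eq0 ?denom_ratioP // Dp mul0r oppr0 mulr0.
Qed.

Lemma pb_derivation (K : fieldType) (m : nat) br (f : torus_field K m) :
  poisson_bracket br -> derivation (br f) /\ forall c, br f (cst m c) = 0.
Proof.
move=> [lin sk lz _].
have D : derivation (br f).
  split=> [g h|g h]; last exact: lz.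
  by rewrite sk -[g]mul1r -(cst1 K m) lin cst1 !mul1r opprD -!sk.
split=> // c; have := lin c 1 0 f.
rewrite mulr1 addr0 (sk 1) (sk 0) (der1 D) (der0 D) oppr0 mulr0 addr0.
by rewrite sk => /eqP; rewrite oppr_eq0 => /eqP.
Qed.

Lemma omega_bracket_unique (K : fieldType) (m : nat)
    (Omega : 'rV[int]_m -> 'rV[int]_m -> K) br1 br2 :
  omega_bracket Omega br1 -> omega_bracket Omega br2 ->
  forall f g, br1 f g = br2 f g.
Proof.
move=> [pb1 m1] [pb2 m2] f g.
have dB h : derivation (fun x => br1 h x - br2 h x).
  have [d1 _] := pb_derivation h pb1; have [d2 _] := pb_derivation h pb2.
  split=> u v; first by rewrite (der_add d1) (der_add d2) opprD addrACA.
  rewrite (der_mul d1) (der_mul d2) opprD addrACA.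
  by rewrite -mulrBl -mulrBr.
have cB h c : br1 h (cst m c) - br2 h (cst m c) = 0.
  have [_ ->] := pb_derivation h pb1; have [_ ->] := pb_derivation h pb2.
  by rewrite subr0.
apply/eqP; rewrite -subr_eq0; apply/eqP; move: g.
apply: (der_eq0 (dB f) (cB f)) => k.
rewrite (pb_skew pb1) (pb_skew pb2) -opprD; apply/eqP; rewrite oppr_eq0.
apply/eqP; move: f; apply: (der_eq0 (dB _) (cB _)) => i.
by rewrite -!monom_delta m1 m2 subrr.
Qed.

Lemma bichar_sum (K : fieldType) (m : nat)
    (Omega : 'rV[int]_m -> 'rV[int]_m -> K) a b : skew_bicharacter Omega ->
  Omega a b = \sum_(i < m) \sum_(j < m)
    (a 0 i)%:~R * (b 0 j)%:~R * Omega (delta_mx 0 i) (delta_mx 0 j).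
Proof.
move=> [addl addr sk].
have lin (f : 'rV[int]_m -> K) : (forall u v, f (u + v) = f u + f v) ->
    forall a, f a = \sum_(i < m) (a 0 i)%:~R * f (delta_mx 0 i).
  move=> fD {}a.
  have f0 : f 0 = 0.
    by have := fD 0 0; rewrite addr0 => /eqP; rewrite -subr_eq subrr eq_sym => /eqP.
  have fN u : f (- u) = - f u.
    by apply/eqP; rewrite -addr_eq0 -fD addNr f0.
  have fn u n : f (u *+ n) = n%:R * f u.
    elim: n => [|n IHn]; first by rewrite mulr0n f0 mul0r.
    by rewrite mulrS fD IHn -natr1; ring.
  rewrite {1}[a]row_sum_delta (big_morph f fD f0); apply: eq_bigr => i _.
  have -> (z : int) (u : 'rV[int]_m) : z *: u = u *~ z by rewrite -scaler_int intz.
  case: (a 0 i) => n; first exact: fn.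
  by rewrite NegzE mulrNz fN -pmulrn fn mulrNz -pmulrn mulNr.
rewrite (lin (Omega^~ b)); last by move=> u v; apply: addl.
apply: eq_bigr => i _; rewrite (lin (Omega (delta_mx 0 i))); last exact: addr.
by rewrite mulr_sumr; apply: eq_bigr => j _; rewrite mulrA.
Qed.

Definition euler (K : fieldType) (m : nat) (i : 'I_m) (f : torus_field K m) :=
  yvar K i * fder (mderiv i : {mpoly K[m]} -> {mpoly K[m]}) f.

Lemma euler_derivation (K : fieldType) (m : nat) (i : 'I_m) :
  derivation (@euler K m i).
Proof.
have dD := fder_derivation (@mderivD m K i) (@mderivM m K i).
split=> [f g|f g]; rewrite /euler; first by rewrite (der_add dD) mulrDr.
by rewrite (der_mul dD) mulrDr mulrA; congr (_ + _); rewrite mulrCA.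
Qed.

Lemma euler_cst (K : fieldType) (m : nat) (i : 'I_m) c :
  euler i (cst m c : torus_field K m) = 0.
Proof.
by rewrite /euler fder_tofrac ?mderivC ?tofrac0 ?mulr0 //; apply: mderivM.
Qed.

Lemma euler_yvar (K : fieldType) (m : nat) (i k : 'I_m) :
  euler i (yvar K k) = if i == k then yvar K k else 0.
Proof.
rewrite /euler fder_tofrac; last exact: mderivM.
rewrite mderivX mnm1E eq_sym; case: eqP => [->|_].
  rewrite scale1r (_ : (U_(k) - U_(k))%MM = 0%MM).
    by rewrite mpolyX0 tofrac1 mulr1.
  by apply/mnmP => j; rewrite mnmBE subnn mnmE.
by rewrite scale0r tofrac0 mulr0.
Qed.

Lemma euler_monom (K : fieldType) (m : nat) (i : 'I_m) a :
  euler i (ymonom K a) = (a 0 i)%:~R * ymonom K a.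
Proof.
rewrite /ymonom (der_prod _ (euler_derivation K i) (@yvar_neq0 K m)) mulrC.
congr (_ * _).
rewrite (bigD1 i) //= euler_yvar eqxx divff ?yvar_neq0 //.
rewrite mulr1 big1 ?addr0 // => k ki.
by rewrite euler_yvar eq_sym (negPf ki) mul0r mulr0.
Qed.

Definition euler_bracket (K : fieldType) (m : nat)
    (Omega : 'rV[int]_m -> 'rV[int]_m -> K) (f g : torus_field K m) :=
  \sum_(i < m) \sum_(j < m)
    cst m (Omega (delta_mx 0 i) (delta_mx 0 j)) * (euler i f * euler j g).

Lemma euler_bracket_monom (K : fieldType) (m : nat)
    (Omega : 'rV[int]_m -> 'rV[int]_m -> K) a b : skew_bicharacter Omega ->
  euler_bracket Omega (ymonom K a) (ymonom K b)
  = cst m (Omega a b) * ymonom K a * ymonom K b.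
Proof.
move=> hO; rewrite (bichar_sum a b hO) cst_sum -mulrA mulr_suml.
apply: eq_bigr => i _; rewrite cst_sum mulr_suml; apply: eq_bigr => j _.
rewrite !euler_monom (cstM m (_ * _)) (cstM m (_%:~R)) !cst_int.
by rewrite mulrACA [LHS]mulrA; congr (_ * _); rewrite mulrC.
Qed.

Lemma jacobi_identity (F : fieldType) (ij jk ki x y z : F) :
  jk * (ij * x * y * z + y * (- ki * x * z))
  + ki * (jk * y * z * x + z * (- ij * y * x))
  + ij * (ki * z * x * y + x * (- jk * z * y)) = 0.
Proof. by ring. Qed.

Lemma omega_bracket_exists (K : fieldType) (m : nat)
    (Omega : 'rV[int]_m -> 'rV[int]_m -> K) :
  skew_bicharacter Omega -> exists br, omega_bracket Omega br.
Proof.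
move=> hO; have [addl addr sk] := hO.
pose br := euler_bracket Omega; exists br.
have dE i := euler_derivation K (i : 'I_m).
have skb f g : br f g = - br g f.
  rewrite /br /euler_bracket exchange_big -sumrN /=; apply: eq_bigr => i _.
  rewrite -sumrN; apply: eq_bigr => j _.
  by rewrite sk cstN mulNr (mulrC (euler j f)).
have dbr f : derivation (br f).
  split=> [g h|g h]; rewrite /br /euler_bracket.
  - rewrite -big_split; apply: eq_bigr => i _ /=.
    rewrite -big_split; apply: eq_bigr => j _ /=.
    by rewrite (der_add (dE j)) mulrDr mulrDr.
  - rewrite mulr_suml mulr_sumr -big_split; apply: eq_bigr => i _ /=.
    rewrite mulr_suml mulr_sumr -big_split; apply: eq_bigr => j _ /=.
    rewrite (der_mul (dE j)) mulrDr mulrDr; congr (_ + _).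
      by rewrite !mulrA.
    by rewrite [RHS]mulrCA; congr (_ * _); rewrite [RHS]mulrCA.
have cbr f c : br f (cst m c) = 0.
  rewrite /br /euler_bracket big1 // => i _; rewrite big1 // => j _.
  by rewrite euler_cst !mulr0.
have brm a b : br (ymonom K a) (ymonom K b)
               = cst m (Omega a b) * ymonom K a * ymonom K b.
  exact: euler_bracket_monom.
clearbody br.
split; last exact: brm.
split=> [c f g h||f g h|f g h].
- rewrite skb (der_add (dbr h)) (der_cstM _ (dbr h)) // opprD -mulrN.
  by rewrite -!skb.
- exact: skb.
- exact: der_mul.
pose J f g h := br f (br g h) + br g (br h f) + br h (br f g).
have Jc u v w : J u v w = J v w u by rewrite /J [RHS]addrC addrA.
have dJ u v : derivation (J u v) := cyclic_derivation skb dbr u v.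
have cJ u v c : J u v (cst m c) = 0.
  rewrite /J (skb _ u) (skb (cst m c)) !cbr oppr0.
  by rewrite ?(der0 (dbr u)) ?(der0 (dbr v)) !addr0.
rewrite -/(J f g h); move: h; apply: (der_eq0 (dJ _ _) (cJ _ _)) => k.
rewrite -Jc; move: g; apply: (der_eq0 (dJ _ _) (cJ _ _)) => j.
rewrite -Jc; move: f; apply: (der_eq0 (dJ _ _) (cJ _ _)) => i.
rewrite /J -!monom_delta.
set ei := delta_mx 0 i; set ej := delta_mx 0 j; set ek := delta_mx 0 k.
have cm u a b : br u (br (ymonom K a) (ymonom K b)) = cst m (Omega a b) *
    (br u (ymonom K a) * ymonom K b + ymonom K a * br u (ymonom K b)).
  by rewrite brm -mulrA (der_cstM _ (dbr u)) // (der_mul (dbr u)).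
rewrite !cm !brm (sk ei ek) (sk ej ei) (sk ek ej) !cstN.
exact: jacobi_identity.
Qed.

(* Main.v *)
Require Import Defs.
From mathcomp Require Import all_boot all_order all_algebra.
From mathcomp Require Import fraction mpoly.
From mathcomp Require Import zify ring.
Import Order.TTheory GRing.Theory Num.Theory.
Local Open Scope ring_scope.

(** Write phi(y_k) = y_k u_k.  Unipotence says that u_k - 1 is a Laurent
    polynomial all of whose exponents have positive degree; let S be a finite
    set of such exponents that serves for every k.  The span of the y^a with
    a in the radical of Omega is contained in the Poisson centre, so it
    suffices to show that S can be shrunk until it lies in the radical.

    Suppose that S is not contained in the radical.  Then the cone generated by
    S has an extremal ray through some s0 in S outside the radical
    ([extremal_ray]): there is a weight w that is nonnegative on S and vanishes
    in S exactly on the multiples of s0.  Let p_k be the part of u_k supported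
    on that ray.  Taking the lowest w-homogeneous parts of all relations
    satisfied by phi turns phi into the substitution y_k -> z_k = y_k p_k, and
    what has to be shown is that every p_k is 1 ([ray_part_eq1]); the ray can
    then be deleted from S ([support_in_radical]).

    Two facts give p_k = 1.  First, the lowest part of the bracket relation
    between phi(y_k) and phi(y_l) says that the logarithmic derivatives of the
    p_k are proportional to the numbers Omega(e_k, s0) ([slope_relation]).  As
    Omega is alternating, the product of the p_j^(s_j) has derivative zero for
    each s on the ray, hence equals 1 ([ray_monom_fixed]).  So the substitution
    fixes the monomials on the ray, and in particular it fixes each p_k.
    Secondly, phi maps the Laurent polynomial psi(y_k) to y_k = z_k / p_k.
    Comparing lowest parts, the lowest part h of psi(y_k) is a Laurent
    polynomial that the substitution maps to z_k / p_k, so the substitution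
    sends p_k h to z_k.  The substitution is injective, because it
    is unipotent for the degree; hence p_k h = y_k, so p_k is a unit of K[T]
    with lowest term 1, which forces p_k = 1 ([unit_eq1]).

    Lowest parts are taken directly in the field K(T).  The weight w gives the
    Euler derivation D for which y^a is an eigenvector of eigenvalue w(a), and
    f has lowest part g in weight n when f = P(1) / Q(1) for polynomials P, Q
    over K(T) whose j-th coefficients are eigenvectors of eigenvalues n + j and
    j, with Q(0) = 1 and P(0) = g ([init]).  Setting the variable to 1 is
    injective on such polynomials ([hpoly_eval_eq0]), so g depends on f and n
    only. *)

Set Implicit Arguments.
Unset Strict Implicit.
Unset Printing Implicit Defensive.

(** * Lowest homogeneous parts with respect to a derivation *)

Definition char0 (R : nzRingType) : Prop := forall z : int, z%:~R = 0 :> R -> z = 0.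

Lemma derN (F : fieldType) (D : F -> F) f : derivation D -> D (- f) = - D f.
Proof.
by move=> dD; apply/eqP; rewrite -addr_eq0 -(der_add dD) addNr (der0 dD).
Qed.

Lemma der_intM (F : fieldType) (D : F -> F) (z : int) f :
  derivation D -> D (z%:~R * f) = z%:~R * D f.
Proof.
move=> dD.
have Dn n : D (n%:R * f) = n%:R * D f.
  rewrite !mulr_natl; elim: n => [|n IHn]; first by rewrite !mulr0n (der0 dD).
  by rewrite !mulrS (der_add dD) IHn.
by case: z => n; rewrite ?NegzE ?mulrNz -!pmulrn ?mulNr ?(derN _ dD) Dn.
Qed.

(** A formal family t -> P(t) on which D acts as n + t d/dt: the image of an
    element under the scaling y^a -> t^(w(a) - n) y^a, when D multiplies y^a by
    w(a). *)
Definition hpoly (F : fieldType) (D : F -> F) (n : int) (P : {poly F}) : Prop :=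
  forall j, D P`_j = (n + j%:Z)%:~R * P`_j.

(** Eigenvectors of D for distinct eigenvalues are linearly independent.  In
    degree at most N, applying D - (n + N) to P(1) = 0 kills the coefficient of
    index N and multiplies the others by nonzero integers, so induction
    applies. *)
Lemma hpoly_eval_eq0 (F : fieldType) (D : F -> F) n (P : {poly F}) :
  derivation D -> char0 F -> hpoly D n P -> P.[1] = 0 -> P = 0.
Proof.
move=> dD iF; move: {2}(size P) (leqnn (size P)) => N.
elim: N P => [|N IH] P sP hP P1; first by apply/eqP; rewrite -size_poly_leq0.
have E (Q : {poly F}) : (size Q <= N.+1)%N -> Q.[1] = \sum_(j < N.+1) Q`_j.
  move=> sQ; rewrite (horner_coef_wide _ sQ); apply: eq_bigr => j _.
  by rewrite expr1n mulr1.
pose G : {poly F} := \poly_(j < N) ((j%:Z - N%:Z)%:~R * P`_j).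
have sG : (size G <= N)%N by exact: size_poly.
have G0 : G = 0.
  apply: IH => // [j|].
    rewrite coef_poly; case: ifP => _; last by rewrite (der0 dD) mulr0.
    by rewrite (der_intM _ _ dD) hP mulrCA.
  have: D P.[1] - (n + N%:Z)%:~R * P.[1] = 0.
    by rewrite P1 (der0 dD) mulr0 subr0.
  rewrite (E P sP) (der_sum _ _ dD) mulr_sumr -sumrB => e.
  rewrite E; last exact: leqW.
  rewrite -[RHS]e; apply: eq_bigr => j _; rewrite hP -mulrBl -rmorphB /=.
  rewrite coef_poly opprD addrACA subrr add0r.
  case: ltnP => // Nj; rewrite (_ : nat_of_ord j = N) ?subrr ?mul0r //.
    by have := ltn_ord j; lia.
have Pj j : (j < N)%N -> P`_j = 0.
  move=> jN; have := coef_poly N (fun j => (j%:Z - N%:Z)%:~R * P`_j) j.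
  rewrite -/G G0 coef0 jN => /esym/eqP; rewrite mulf_eq0 => /orP[]/eqP // /iF.
  by lia.
have PN : P`_N = 0.
  move: P1; rewrite (E P sP) big_ord_recr /= big1 ?add0r // => j _.
  exact: Pj.
apply/polyP => j; rewrite coef0; case: (ltngtP j N) => [/Pj||->] // Nj.
by rewrite nth_default // (leq_trans sP).
Qed.

Lemma hpolyD (F : fieldType) (D : F -> F) n (P Q : {poly F}) :
  derivation D -> hpoly D n P -> hpoly D n Q -> hpoly D n (P + Q).
Proof. by move=> dD hP hQ j; rewrite coefD (der_add dD) hP hQ mulrDr. Qed.

Lemma hpolyB (F : fieldType) (D : F -> F) n (P Q : {poly F}) :
  derivation D -> hpoly D n P -> hpoly D n Q -> hpoly D n (P - Q).
Proof.
move=> dD hP hQ j.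
by rewrite coefB (der_add dD) (derN _ dD) hP hQ mulrDr mulrN.
Qed.

Lemma hpolyM (F : fieldType) (D : F -> F) n n' (P Q : {poly F}) :
  derivation D -> hpoly D n P -> hpoly D n' Q -> hpoly D (n + n') (P * Q).
Proof.
move=> dD hP hQ j; rewrite coefM (der_sum _ _ dD) mulr_sumr.
apply: eq_bigr => i _; rewrite (der_mul dD) hP hQ mulrCA -mulrA -mulrDl mulrA.
rewrite -rmorphD /= mulrA; congr (_%:~R * _ * _).
by have := ltn_ord i; lia.
Qed.

Lemma hpolyC (F : fieldType) (D : F -> F) n f :
  derivation D -> D f = n%:~R * f -> hpoly D n f%:P.
Proof.
move=> dD Df j; rewrite coefC; case: eqP => [->|_]; first by rewrite addr0.
by rewrite (der0 dD) mulr0.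
Qed.

Lemma hpolyXn (F : fieldType) (D : F -> F) n k (P : {poly F}) :
  derivation D -> hpoly D n P -> hpoly D (n - k%:Z) ('X^k * P).
Proof.
move=> dD hP j; rewrite coefXnM; case: ltnP => kj.
  by rewrite (der0 dD) mulr0.
by rewrite hP; congr (_%:~R * _); lia.
Qed.

(** In weight n the element f has lowest part g; g = 0 means that f starts in
    a higher weight.  The denominator Q makes the relation stable under
    inversion, and Q(0) = 1 is a harmless normalization, as the constant
    coefficient of Q has eigenvalue 0. *)
Definition init (F : fieldType) (D : F -> F) (n : int) (f g : F) : Prop :=
  exists P Q : {poly F}, [/\ hpoly D n P, hpoly D 0 Q, Q`_0 = 1,
    f * Q.[1] = P.[1] & g = P`_0].

Lemma hpoly1 (F : fieldType) (D : F -> F) : derivation D -> hpoly D 0 1.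
Proof. by move=> dD; apply: hpolyC; rewrite // (der1 dD) mul0r. Qed.

Lemma init_poly (F : fieldType) (D : F -> F) n (P : {poly F}) :
  derivation D -> hpoly D n P -> init D n P.[1] P`_0.
Proof.
move=> dD hP; exists P, 1; split=> //; first exact: hpoly1.
  by rewrite coef1.
by rewrite hornerC mulr1.
Qed.

Lemma init_eigen (F : fieldType) (D : F -> F) n f :
  derivation D -> D f = n%:~R * f -> init D n f f.
Proof.
by move=> dD /(hpolyC dD)/(init_poly dD); rewrite hornerC coefC.
Qed.

(** Cross-multiplying two presentations of f gives a homogeneous polynomial
    that vanishes at 1, hence is zero; its constant coefficient is g - g'. *)
Lemma init_fun (F : fieldType) (D : F -> F) n f g g' :
  derivation D -> char0 F -> init D n f g -> init D n f g' -> g = g'.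
Proof.
move=> dD iF [P [Q [hP hQ Q0 e ->]]] [P' [Q' [hP' hQ' Q0' e' ->]]].
have: P * Q' - P' * Q = 0.
  apply: (hpoly_eval_eq0 (D := D) (n := n) dD iF).
    by rewrite -[n]addr0; apply: (hpolyB dD); apply: hpolyM.
  by rewrite hornerD hornerN !hornerM -e -e' mulrAC subrr.
move/(congr1 (fun p : {poly F} => p`_0)).
by rewrite coefB coef0 !coef0M Q0 Q0' !mulr1 => /eqP; rewrite subr_eq0 => /eqP.
Qed.

Lemma initD (F : fieldType) (D : F -> F) n f g f' g' :
  derivation D -> init D n f g -> init D n f' g' -> init D n (f + f') (g + g').
Proof.
move=> dD [P [Q [hP hQ Q0 e ->]]] [P' [Q' [hP' hQ' Q0' e' ->]]].
exists (P * Q' + P' * Q), (Q * Q'); split.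
- by rewrite -[n]addr0; apply: (hpolyD dD); apply: hpolyM.
- by rewrite -[0]addr0; apply: hpolyM.
- by rewrite coef0M Q0 Q0' mulr1.
- by rewrite hornerD !hornerM -e -e'; ring.
- by rewrite coefD !coef0M Q0 Q0' !mulr1.
Qed.

Lemma initM (F : fieldType) (D : F -> F) n n' f g f' g' :
  derivation D -> init D n f g -> init D n' f' g' ->
  init D (n + n') (f * f') (g * g').
Proof.
move=> dD [P [Q [hP hQ Q0 e ->]]] [P' [Q' [hP' hQ' Q0' e' ->]]].
exists (P * P'), (Q * Q'); split.
- exact: hpolyM.
- by rewrite -[0]addr0; apply: hpolyM.
- by rewrite coef0M Q0 Q0' mulr1.
- by rewrite !hornerM -e -e'; ring.
- by rewrite !coef0M.
Qed.

(** Numerator and denominator are exchanged after division by the eigenvector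
    g, which restores both the weights and the normalization. *)
Lemma initV (F : fieldType) (D : F -> F) n f g :
  derivation D -> char0 F -> g != 0 -> init D n f g -> init D (- n) f^-1 g^-1.
Proof.
move=> dD iF g0 [P [Q [hP hQ Q0 e eg]]].
have hg : hpoly D (- n) (g^-1)%:P.
  apply: hpolyC => //; rewrite (der_inv dD g0).
  rewrite eg hP addr0 -eg mulrNz; field; exact: g0.
have P1 : P.[1] != 0.
  apply: contra_neq g0 => /(hpoly_eval_eq0 dD iF hP) P0.
  by rewrite eg P0 coef0.
have f0 : f != 0 by apply: contra_neq P1 => f0; rewrite -e f0 mul0r.
exists (g^-1%:P * Q), (g^-1%:P * P); split.
- by rewrite -[- n]addr0; apply: hpolyM.
- by rewrite -[0](addNr n); apply: hpolyM.
- by rewrite coefCM -eg mulVf.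
- by rewrite !hornerM hornerC -e; field; rewrite f0 g0.
- by rewrite coefCM Q0 mulr1.
Qed.

(** Multiplying the numerator by a power of the variable lowers its weight
    without changing its value at 1. *)
Lemma init_gt (F : fieldType) (D : F -> F) n k f g :
  derivation D -> k < n -> init D n f g -> init D k f 0.
Proof.
move=> dD kn [P [Q [hP hQ Q0 e _]]].
have e' : n - `|n - k|%N%:Z = k by lia.
exists ('X^`|n - k|%N * P), Q; split => //.
- by have := hpolyXn `|n - k|%N dD hP; rewrite e'.
- by rewrite hornerM hornerXn expr1n mul1r.
- by rewrite coefXnM; case: ltnP => //; lia.
Qed.

Lemma init_inj (F : fieldType) (D : F -> F) n n' f g g' :
  derivation D -> char0 F -> g != 0 -> g' != 0 ->
  init D n f g -> init D n' f g' -> n = n' /\ g = g'.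
Proof.
move=> dD iF g0 g0' h h'.
case: (ltgtP n n') => [lt|lt|E].
- have := init_fun dD iF h (init_gt dD lt h') => g1.
  by rewrite g1 eqxx in g0.
- have := init_fun dD iF h' (init_gt dD lt h) => g1.
  by rewrite g1 eqxx in g0'.
by split=> //; rewrite -E in h'; apply: init_fun h h'.
Qed.

Lemma init_sum (F : fieldType) (D : F -> F) n (I : eqType) (r : seq I)
    (f g : I -> F) :
  derivation D -> (forall i, i \in r -> init D n (f i) (g i)) ->
  init D n (\sum_(i <- r) f i) (\sum_(i <- r) g i).
Proof.
move=> dD; elim: r => [|i r IH] h.
  rewrite !big_nil; apply: init_eigen => //; by rewrite (der0 dD) mulr0.
rewrite !big_cons; apply: initD => //; first by apply: h; rewrite mem_head.
by apply: IH => j jr; apply: h; rewrite in_cons jr orbT.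
Qed.

Lemma init1 (F : fieldType) (D : F -> F) : derivation D -> init D 0 1 1.
Proof. by move=> dD; apply: init_eigen; rewrite // (der1 dD) mul0r. Qed.

Lemma initX (F : fieldType) (D : F -> F) n k f g :
  derivation D -> init D n f g -> init D (n * k%:Z) (f ^+ k) (g ^+ k).
Proof.
move=> dD h; elim: k => [|k IH]; first by rewrite mulr0 !expr0; apply: init1.
rewrite !exprS; have -> : n * k.+1%:Z = n + n * k%:Z by lia.
exact: initM.
Qed.

Lemma init_expz (F : fieldType) (D : F -> F) n (z : int) f g :
  derivation D -> char0 F -> g != 0 -> init D n f g ->
  init D (n * z) (f ^ z) (g ^ z).
Proof.
move=> dD iF g0 h; case: z => k; first exact: (initX k dD h).
rewrite NegzE mulrN -!exprnN; apply: initV => //; first exact: expf_neq0.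
exact: (initX k.+1 dD h).
Qed.

Lemma init_prod (F : fieldType) (D : F -> F) (I : eqType) (r : seq I)
    (n : I -> int) (f g : I -> F) :
  derivation D -> (forall i, init D (n i) (f i) (g i)) ->
  init D (\sum_(i <- r) n i) (\prod_(i <- r) f i) (\prod_(i <- r) g i).
Proof.
move=> dD h; elim: r => [|i r IH]; first by rewrite !big_nil; apply: init1.
by rewrite !big_cons; apply: initM.
Qed.

(** * Weights and extremal rays of cones *)

Lemma mdegreeD m (w : 'I_m -> int) a b :
  mdegree w (a + b) = mdegree w a + mdegree w b.
Proof.
by rewrite /mdegree -big_split; apply: eq_bigr => k _; rewrite mxE mulrDr.
Qed.

Lemma mdegreeZ m (w : 'I_m -> int) x a : mdegree w (x *: a) = x * mdegree w a.
Proof. by rewrite /mdegree mulr_sumr; apply: eq_bigr => k _; rewrite mxE mulrCA. Qed.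

Lemma mdegree0 m (w : 'I_m -> int) : mdegree w 0 = 0.
Proof. by rewrite /mdegree big1 // => k _; rewrite mxE mulr0. Qed.

Lemma mdegreeB m (w : 'I_m -> int) a b :
  mdegree w (a - b) = mdegree w a - mdegree w b.
Proof. by rewrite mdegreeD -scaleN1r mdegreeZ mulN1r. Qed.

Lemma mdegree_delta m (w : 'I_m -> int) k : mdegree w (delta_mx 0 k) = w k.
Proof.
rewrite /mdegree (bigD1 k) //= mxE !eqxx mulr1 big1 ?addr0 // => i ik.
by rewrite mxE (negPf ik) andbF mulr0.
Qed.

Lemma mdegree_comb m (g h : 'I_m -> int) x y a :
  mdegree (fun k => x * g k - y * h k) a = x * mdegree g a - y * mdegree h a.
Proof.
rewrite /mdegree !mulr_sumr -sumrB.
by apply: eq_bigr => k _; rewrite mulrBl !mulrA.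
Qed.

Definition sqnorm m (a : 'rV[int]_m) : int := mdegree (a 0) a.

Lemma sqnorm_ge0 m (a : 'rV[int]_m) : 0 <= sqnorm a.
Proof. by apply: sumr_ge0 => k _; rewrite -expr2 sqr_ge0. Qed.

Lemma sqnorm_eq0 m (a : 'rV[int]_m) : sqnorm a = 0 -> a = 0.
Proof.
move/eqP; rewrite psumr_eq0 => [/allP h|k _]; last by rewrite -expr2 sqr_ge0.
apply/rowP => k; rewrite mxE; have := h k (mem_index_enum k).
by rewrite /= mulf_eq0 orbb => /eqP.
Qed.

(** The integral points of a linear subspace. *)
Definition saturated m (R : pred 'rV[int]_m) : Prop :=
  [/\ R 0, forall a b x y, R a -> R b -> R (x *: a + y *: b)
   & forall x a, x != 0 -> R (x *: a) -> R a].

(** Fraction-free Gaussian elimination.  If the functional g found for the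
    first vectors does not kill r, then s is replaced by a combination s' of s
    and r that g kills; a functional h for s' is combined with g into one that
    kills r, and whose value at s is h(s'). *)
Lemma separating_functional m (R : pred 'rV[int]_m) rs s :
  saturated R -> all R rs -> ~~ R s ->
  exists2 g : 'I_m -> int, (forall r, r \in rs -> mdegree g r = 0)
    & mdegree g s != 0.
Proof.
move=> [R0 Rlin Rsat]; elim: rs s => [|r rs IH] s.
  move=> _ Rs; exists (s 0) => //; apply: contra Rs => /eqP/sqnorm_eq0->.
  exact: R0.
move=> /= /andP[Rr Rrs] Rs.
have [g g0 gs] := IH s Rrs Rs.
have [gr|gr] := eqVneq (mdegree g r) 0.
  by exists g => // t; rewrite in_cons => /orP[/eqP->|/g0].
have Rs' : ~~ R (mdegree g r *: s + (- mdegree g s) *: r).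
  apply: contra Rs => Rs'; apply: (Rsat _ _ gr).
  have := Rlin _ _ 1 (mdegree g s) Rs' Rr.
  by rewrite scale1r scaleNr subrK.
have [h h0 hs] := IH _ Rrs Rs'.
exists (fun k => mdegree g r * h k - mdegree h r * g k).
  move=> t; rewrite in_cons mdegree_comb => /orP[/eqP->|tr].
    by rewrite mulrC subrr.
  by rewrite (h0 t tr) (g0 t tr) !mulr0 subrr.
by rewrite mdegree_comb; move: hs; rewrite mdegreeD !mdegreeZ mulNr (mulrC (mdegree g s)).
Qed.

Lemma exists_max (R : realDomainType) (T : eqType) (f : T -> R) (s : seq T) x0 :
  x0 \in s -> exists2 x, x \in s & forall y, y \in s -> f y <= f x.
Proof.
elim: s x0 => // x s IH x0 _.
case: s IH => [|y s] IH.
  by exists x; rewrite ?mem_head // => y; rewrite mem_seq1 => /eqP->.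
have [z zs zmax] := IH y (mem_head _ _).
have [xz|zx] := leP (f x) (f z).
  exists z; first by rewrite in_cons zs orbT.
  by move=> t; rewrite in_cons => /orP[/eqP->|/zmax].
exists x; first exact: mem_head.
move=> t; rewrite in_cons => /orP[/eqP->//|/zmax/le_trans]; apply.
exact: ltW.
Qed.

(** A positive definite form, made large off the hyperplane g = 0 by the
    choice of N; [bform] is its polar form. *)
Definition qform m (g : 'I_m -> int) (N : int) (a : 'rV[int]_m) : int :=
  sqnorm a + N * mdegree g a ^+ 2.

Definition bform m (g : 'I_m -> int) (N : int) (a b : 'rV[int]_m) : int :=
  mdegree (a 0) b + N * mdegree g a * mdegree g b.

Lemma qform_comb m (g : 'I_m -> int) N x y (a b : 'rV[int]_m) :
  qform g N (x *: a - y *: b)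
  = x ^+ 2 * qform g N a - x * y * bform g N b a *+ 2 + y ^+ 2 * qform g N b.
Proof.
have E : sqnorm (x *: a - y *: b)
   = x ^+ 2 * sqnorm a - x * y * mdegree (b 0) a *+ 2 + y ^+ 2 * sqnorm b.
  rewrite /sqnorm /mdegree !mulr_sumr -sumrMnl -sumrB -big_split /=.
  by apply: eq_bigr => k _; rewrite !mxE; ring.
by rewrite /qform /bform E mdegreeB !mdegreeZ; ring.
Qed.

(** On the slice of degree 1, a positive definite quadratic form takes its
    maximum over the finite set of the s / deg s at a point s0 / deg s0, and by
    Cauchy-Schwarz the polar form with s0 then has its maximum over this set at
    that point only.  The difference of the two sides of this inequality, made
    homogeneous, is the weight w.  The form |s|^2 + N g(s)^2, with g zero on
    the elements of R and nonzero at one element of S, has its maximum outside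
    R when N is large. *)
Lemma extremal_ray m (d : 'I_m -> int) (R : pred 'rV[int]_m) (S : seq 'rV[int]_m) s :
  saturated R -> (forall t, t \in S -> 0 < mdegree d t) -> s \in S -> ~~ R s ->
  exists s0 (w : 'I_m -> int),
    [/\ s0 \in S, ~~ R s0, mdegree w s0 = 0, forall t, t \in S -> 0 <= mdegree w t
     & forall t, t \in S -> mdegree w t = 0 ->
         mdegree d s0 *: t = mdegree d t *: s0].
Proof.
move=> satR dS sS Rs.
have [|g g0 gs] := separating_functional (rs := filter R S) satR _ Rs.
  exact: filter_all.
(* With this N the value at s beats the value of every t with g(t) = 0, even
   after rescaling both to degree 1. *)
pose N := 1 + (\sum_(t <- S) sqnorm t) * mdegree d s ^+ 2.
have N1 t : t \in S -> 1 + sqnorm t * mdegree d s ^+ 2 <= N.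
  move=> tS; rewrite lerD2l ler_wpM2r ?sqr_ge0 //.
  by rewrite (big_rem t) //= lerDl sumr_ge0 // => u _; apply: sqnorm_ge0.
have N0 : 0 <= N.
  by apply: le_trans (N1 s sS); rewrite addr_ge0 // mulr_ge0 ?sqnorm_ge0 ?sqr_ge0.
have [s0 s0S max0] := exists_max
  (fun t => (qform g N t)%:~R / (mdegree d t ^+ 2)%:~R : rat) sS.
have max t : t \in S ->
    qform g N t * mdegree d s0 ^+ 2 <= qform g N s0 * mdegree d t ^+ 2.
  move=> tS; have := max0 t tS; rewrite ler_pdivrMr ?ltr0z ?exprn_gt0 ?dS //.
  rewrite mulrAC ler_pdivlMr ?ltr0z ?exprn_gt0 ?dS //.
  by rewrite -!intrM ler_int.
have q0 a : 0 <= qform g N a.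
  by rewrite addr_ge0 ?sqnorm_ge0 // mulr_ge0 // sqr_ge0.
pose h k := s0 0 k + N * mdegree g s0 * g k.
have hE t : mdegree h t = bform g N s0 t.
  rewrite /bform {1}/mdegree /h; move: (N * _) => c; under eq_bigr => k _ do rewrite mulrDl.
  rewrite big_split /=; congr (_ + _); rewrite [mdegree g t]/mdegree mulr_sumr.
  by apply: eq_bigr => k _; rewrite !mulrA.
pose w k := qform g N s0 * d k - mdegree d s0 * h k.
have wE t : mdegree w t = mdegree d t * qform g N s0
                        - mdegree d s0 * bform g N s0 t.
  by rewrite mdegree_comb hE mulrC.
have key t : t \in S -> qform g N (mdegree d s0 *: t - mdegree d t *: s0)
                       <= mdegree d t * mdegree w t *+ 2.
  move=> tS; rewrite qform_comb wE.
  by have := max t tS; lia.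
exists s0, w; split => //.
- apply/negP => Rs0; have gs0 : mdegree g s0 = 0.
    by apply: g0; rewrite mem_filter; apply/andP.
  have := max s sS; rewrite leNgt => /negP; apply.
  rewrite {1 2}/qform gs0 expr0n mulr0 addr0.
  apply: (@lt_le_trans _ _ N); first by apply: lt_le_trans (N1 s0 s0S); lia.
  rewrite -[N in N <= _]mulr1; apply: ler_pM => //.
    have := sqnorm_ge0 s; have : 1 <= mdegree g s ^+ 2 by nia.
    nia.
  have := dS s0 s0S; nia.
- by rewrite wE /bform /qform /sqnorm; ring.
- move=> t tS; have := le_trans (q0 _) (key t tS); have := dS t tS; nia.
move=> t tS wt0; have := key t tS; rewrite wt0 mulr0 mul0rn => le0.
have {}le0 : qform g N (mdegree d s0 *: t - mdegree d t *: s0) = 0.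
  by apply: le_anti; rewrite le0 q0.
apply/eqP; rewrite -subr_eq0; apply/eqP/sqnorm_eq0.
move: le0; rewrite /qform => /eqP.
by rewrite paddr_eq0 ?sqnorm_ge0 ?(mulr_ge0 N0 (sqr_ge0 _)) // => /andP[/eqP].
Qed.

(** * Euler derivations and spans of Laurent monomials *)

Lemma pchar0_char0 (K : fieldType) : [pchar K] =i pred0 -> char0 K.
Proof.
move/pcharf0P => h [] n; first by rewrite -pmulrn => /eqP; rewrite h => /eqP->.
by rewrite NegzE mulrNz -pmulrn => /eqP; rewrite oppr_eq0 h.
Qed.

Lemma cst_eq0 (K : fieldType) m (c : K) : (cst m c == 0) = (c == 0).
Proof. by rewrite /cst tofrac_eq0 mpolyC_eq0. Qed.

Lemma torus_char0 (K : fieldType) m : char0 K -> char0 (torus_field K m).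
Proof. by move=> iK z; rewrite -cst_int => /eqP; rewrite cst_eq0 => /eqP/iK. Qed.

Lemma ymonomD (K : fieldType) m (a b : 'rV[int]_m) :
  ymonom K (a + b) = ymonom K a * ymonom K b.
Proof.
rewrite /ymonom -big_split; apply: eq_bigr => k _ /=.
by rewrite mxE expfzDr ?yvar_neq0.
Qed.

Lemma ymonom0 (K : fieldType) m : ymonom K (0 : 'rV[int]_m) = 1.
Proof. by rewrite /ymonom big1 // => k _; rewrite mxE expr0z. Qed.

Lemma ymonom_neq0 (K : fieldType) m (a : 'rV[int]_m) : ymonom K a != 0.
Proof. by apply/prodf_neq0 => k _; rewrite expfz_neq0 ?yvar_neq0. Qed.

Lemma ymonomN (K : fieldType) m (a : 'rV[int]_m) :
  ymonom K (- a) = (ymonom K a)^-1.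
Proof.
by apply: (mulfI (ymonom_neq0 K a)); rewrite -ymonomD subrr ymonom0 divff ?ymonom_neq0.
Qed.

(** The Euler derivation of the grading in which y_k has weight w_k. *)
Definition wder (K : fieldType) m (w : 'I_m -> int) (f : torus_field K m) :=
  \sum_(k < m) (w k)%:~R * euler k f.

Lemma wder_derivation (K : fieldType) m (w : 'I_m -> int) : derivation (@wder K m w).
Proof.
have dE k := @euler_derivation K m k.
split=> f g; rewrite /wder.
  by rewrite -big_split; apply: eq_bigr => k _; rewrite /= (der_add (dE k)) mulrDr.
rewrite mulr_suml mulr_sumr -big_split /=; apply: eq_bigr => k _.
by rewrite (der_mul (dE k)); ring.
Qed.

Lemma wder_cstM (K : fieldType) m (w : 'I_m -> int) c (f : torus_field K m) :
  wder w (cst m c * f) = cst m c * wder w f.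
Proof.
rewrite (der_mul (wder_derivation K w)) {1}/wder big1 ?mul0r ?add0r // => k _.
by rewrite euler_cst mulr0.
Qed.

Lemma wder_monom (K : fieldType) m (w : 'I_m -> int) a :
  wder w (ymonom K a) = (mdegree w a)%:~R * ymonom K a.
Proof.
rewrite /wder /mdegree rmorph_sum mulr_suml; apply: eq_bigr => k _ /=.
by rewrite euler_monom mulrA -rmorphM.
Qed.

Section Span.
Variables (K : fieldType) (m : nat).
Implicit Types (P Q : pred 'rV[int]_m) (f g : torus_field K m).

Lemma span0 P : span_monoms P (0 : torus_field K m).
Proof. by exists [::]; rewrite ?big_nil. Qed.

Lemma spanD P f g : span_monoms P f -> span_monoms P g -> span_monoms P (f + g).
Proof.
move=> [s Ps ->] [t Pt ->]; exists (s ++ t); first by rewrite all_cat Ps.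
by rewrite big_cat.
Qed.

Lemma span_term P c a : P a -> span_monoms P (cst m c * ymonom K a).
Proof. by move=> Pa; exists [:: (c, a)]; rewrite ?big_seq1 //= Pa. Qed.

Lemma span_ind P (H : torus_field K m -> Prop) :
  H 0 -> (forall c a f, P a -> H f -> H (cst m c * ymonom K a + f)) ->
  forall f, span_monoms P f -> H f.
Proof.
move=> H0 HD f [s Ps ->] {f}; elim: s Ps => [|[c a] s IH] /=.
  by rewrite big_nil.
by move=> /andP[Pa /IH Hs]; rewrite big_cons; apply: HD.
Qed.

Lemma span_sub P Q f : (forall a, P a -> Q a) -> span_monoms P f -> span_monoms Q f.
Proof. by move=> PQ [s Ps ->]; exists s => //; apply: sub_all Ps => t /PQ. Qed.

Lemma span_sum P (I : eqType) (r : seq I) (F : I -> torus_field K m) :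
  (forall i, i \in r -> span_monoms P (F i)) -> span_monoms P (\sum_(i <- r) F i).
Proof.
elim: r => [|i r IH] h; first by rewrite big_nil; apply: span0.
rewrite big_cons; apply: spanD; first by apply: h; rewrite mem_head.
by apply: IH => j jr; apply: h; rewrite in_cons jr orbT.
Qed.

Lemma spanZ P c f : span_monoms P f -> span_monoms P (cst m c * f).
Proof.
elim/span_ind => [|c' a g Pa IH]; first by rewrite mulr0; apply: span0.
rewrite mulrDr mulrA -cstM; apply: spanD => //; exact: span_term.
Qed.

Lemma spanMmonom P Q b f : (forall a, P a -> Q (a + b)) ->
  span_monoms P f -> span_monoms Q (f * ymonom K b).
Proof.
move=> PQ; elim/span_ind => [|c a g Pa IH]; first by rewrite mul0r; apply: span0.
rewrite mulrDl -mulrA -ymonomD; apply: spanD => //; apply: span_term.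
exact: PQ.
Qed.

Lemma span_split P Q f : span_monoms P f ->
  exists f1 f2, [/\ f = f1 + f2, span_monoms (fun a => P a && Q a) f1
                  & span_monoms (fun a => P a && ~~ Q a) f2].
Proof.
elim/span_ind => [|c a g Pa [g1 [g2 [-> h1 h2]]]].
  by exists 0, 0; rewrite addr0; split => //; apply: span0.
have [Qa|Qa] := boolP (Q a).
  exists (cst m c * ymonom K a + g1), g2; rewrite addrA; split => //.
  by apply: spanD => //; apply: span_term; rewrite Pa.
exists g1, (cst m c * ymonom K a + g2); rewrite addrCA; split => //.
by apply: spanD => //; apply: span_term; rewrite Pa.
Qed.

Lemma span_eigen (w : 'I_m -> int) n f :
  span_monoms (fun a => mdegree w a == n) f -> wder w f = n%:~R * f.
Proof.
have dw := wder_derivation K w.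
elim/span_ind => [|c a g /eqP ha IH]; first by rewrite (der0 dw) mulr0.
by rewrite (der_add dw) wder_cstM wder_monom ha IH mulrDr [in RHS]mulrCA.
Qed.

Lemma span_hpoly (w : 'I_m -> int) n f :
  span_monoms (fun a => n <= mdegree w a) f ->
  exists2 P, hpoly (@wder K m w) n P & f = P.[1].
Proof.
have dw := wder_derivation K w.
elim/span_ind => [|c a g ha [P hP ->]].
  exists 0; last by rewrite horner0.
  by move=> j; rewrite coef0 (der0 dw) mulr0.
pose k := `|mdegree w a - n|%N.
exists ('X^k * (cst m c * ymonom K a)%:P + P).
  apply: hpolyD => //; have -> : n = mdegree w a - k%:Z by rewrite /k; lia.
  apply: hpolyXn => //; apply: hpolyC => //.
  by rewrite wder_cstM wder_monom mulrCA.
by rewrite hornerD hornerM hornerXn expr1n mul1r hornerC.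
Qed.

Lemma span_init_eigen (w : 'I_m -> int) n f :
  span_monoms (fun a => mdegree w a == n) f -> init (@wder K m w) n f f.
Proof. by move/span_eigen; apply: init_eigen; apply: wder_derivation. Qed.

Lemma span_init_gt (w : 'I_m -> int) n f :
  span_monoms (fun a => n < mdegree w a) f -> init (@wder K m w) n f 0.
Proof.
have dw := wder_derivation K w.
move=> h; have [|P hP ->] := @span_hpoly w (n + 1) f.
  by apply: span_sub h => a; lia.
by apply: (init_gt dw _ (init_poly dw hP)); lia.
Qed.

Lemma coord_ring_bounded (w : 'I_m -> int) f : coord_ring f ->
  exists n, span_monoms (fun a => n <= mdegree w a) f.
Proof.
elim/span_ind => [|c a g _ [n h]]; first by exists 0; apply: span0.
exists (Num.min n (mdegree w a)); apply: spanD.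
  by apply: span_term; rewrite ge_min lexx orbT.
by apply: span_sub h => b; apply: le_trans; rewrite ge_min lexx.
Qed.

(** The units of K[T] are the scalar multiples of monomials.  Scaled along the
    degree, f and h become polynomials in one variable t whose product is a
    power of t, and the first has constant coefficient 1; so it is coprime to t
    and divides a power of t. *)
Lemma unit_eq1 (d : 'I_m -> int) f h : char0 K ->
  span_monoms (fun a => 0 < mdegree d a) (f - 1) -> coord_ring h ->
  f * h = 1 -> f = 1.
Proof.
move=> iK hf hh fh; have iF := torus_char0 (m := m) iK.
have dd := wder_derivation K d.
have [|P hP eP] := @span_hpoly d 1 (f - 1).
  by apply: span_sub hf => a; lia.
have [n hn] := coord_ring_bounded d hh.
have [|Q hQ eQ] := @span_hpoly d (- `|n|%N%:Z) h.
  by apply: span_sub hn => a; lia.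
pose P1 : {poly torus_field K m} := 1 + 'X^1 * P.
have P1E : P1.[1] = f.
  by rewrite hornerD hornerM hornerXn expr1n mul1r hornerC -eP addrC subrK.
have hP1 : hpoly (wder d) 0 P1.
  by apply: hpolyD => //; [exact: hpoly1 | exact: (hpolyXn 1 dd hP)].
have P10 : P1.[0] = 1.
  by rewrite hornerD hornerM hornerXn expr1 mul0r addr0 hornerC.
have E : P1 * Q = 'X^`|n|.
  apply/eqP; rewrite -subr_eq0; apply/eqP.
  apply: (hpoly_eval_eq0 (D := wder d) (n := - `|n|%N%:Z)) => //.
    apply: hpolyB => //; first by rewrite -[- _]add0r; apply: hpolyM.
    have := hpolyXn `|n| dd (hpoly1 dd).
    by rewrite mulr1 sub0r.
  by rewrite hornerD hornerN hornerM hornerXn expr1n P1E -eQ fh subrr.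
have cop : coprimep P1 'X^`|n|.
  by apply: coprimep_expr; rewrite -['X]subr0 coprimep_XsubC /root P10 oner_neq0.
have dv : P1 %| 'X^`|n| by rewrite -E dvdp_mulr.
have : size P1 == 1.
  by move: cop; rewrite coprimep_def (eqp_size (dvdp_gcd_idl dv)).
move/size_poly1P => [c _ e]; move: P10 P1E; rewrite e !hornerC => ->.
by move->.
Qed.

End Span.

(** * Substitutions of Laurent monomials *)

Section Substitution.
Variables (K : fieldType) (m : nat).
Implicit Types (z : 'I_m -> torus_field K m) (A : {mpoly K[m]}).

Definition subst z A : torus_field K m := mmap (@tofrac _ \o @mpolyC m K) z A.

Lemma substM z A B : subst z (A * B) = subst z A * subst z B.
Proof. exact: rmorphM. Qed.

Lemma substD z A B : subst z (A + B) = subst z A + subst z B.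
Proof. exact: rmorphD. Qed.

Lemma substX z mu : subst z 'X_[mu] = \prod_(i < m) z i ^+ mu i.
Proof. exact: mmapX. Qed.

Lemma substZ z c A : subst z (c *: A) = cst m c * subst z A.
Proof. exact: mmapZ. Qed.

Lemma substE z A :
  subst z A = \sum_(mu <- msupp A) cst m A@_mu * \prod_(i < m) z i ^+ mu i.
Proof. by []. Qed.

Lemma subst_neq0 z mu : (forall k, z k != 0) -> subst z 'X_[mu] != 0.
Proof.
move=> z0; rewrite substX; apply/prodf_neq0 => i _; exact: expf_neq0 (z0 i).
Qed.

Lemma subst_morph (phi : {rmorphism torus_field K m -> torus_field K m}) A :
  (forall c, phi (cst m c) = cst m c) ->
  phi (tofrac A) = subst (fun k => phi (yvar K k)) A.
Proof.
move=> phic; rewrite substE {1}[A]mpolyE !rmorph_sum; apply: eq_bigr => mu _ /=.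
rewrite -mul_mpolyC !rmorphM /= -/(cst m _) phic; congr (_ * _).
rewrite mpolyXE_id !rmorph_prod; apply: eq_bigr => i _ /=.
by rewrite !rmorphXn.
Qed.

Lemma subst_yvar A : subst (yvar K) A = tofrac A.
Proof. by rewrite -(@subst_morph idfun). Qed.

(** The lowest part of A(x) is obtained from the monomials of A of least
    weight: these form a nonzero polynomial A', whatever the values z are. *)
Lemma subst_init (w : 'I_m -> int) x z A : (forall k, init (@wder K m w) (w k) (x k) (z k)) ->
  A != 0 -> exists A' n, A' != 0 /\ init (@wder K m w) n (subst x A) (subst z A').
Proof.
move=> h A0; have dw := wder_derivation K w.
pose wt (mu : 'X_{1..m}) := \sum_(i < m) w i * (mu i)%:Z.
have [mu0 mu0A min] : exists2 mu0, mu0 \in msupp A &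
    forall mu, mu \in msupp A -> - wt mu <= - wt mu0.
  by apply: (@exists_max _ _ (fun mu => - wt mu)); apply: mlead_supp.
pose A' := \sum_(mu <- msupp A | wt mu == wt mu0) A@_mu *: 'X_[mu].
exists A', (wt mu0); split.
  apply/eqP => /(congr1 (mcoeff mu0)); rewrite mcoeff0 /A' raddf_sum /=.
  rewrite big_mkcond (bigD1_seq mu0) ?msupp_uniq //= eqxx.
  rewrite mcoeffZ mcoeffX eqxx mulr1.
  rewrite big1_seq ?addr0 => [/eqP|mu /andP[ne _]].
    by rewrite mcoeff_eq0 mu0A.
  by case: ifP => // _; rewrite mcoeffZ mcoeffX (negPf ne) mulr0.
have -> : subst z A' = \sum_(mu <- msupp A)
    (if wt mu == wt mu0 then subst z (A@_mu *: 'X_[mu]) else 0).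
  by rewrite /subst rmorph_sum /= big_mkcond.
rewrite substE; apply: init_sum => // mu muA.
have hmu : init (@wder K m w) (wt mu)
    (cst m A@_mu * \prod_i x i ^+ mu i) (subst z (A@_mu *: 'X_[mu])).
  rewrite substZ substX -[wt mu]add0r; apply: initM => //.
    apply: init_eigen => //; rewrite mul0r -[cst m _]mulr1 wder_cstM.
    by rewrite (der1 dw) mulr0.
  by apply: init_prod => // i; apply: initX.
case: eqP => [<-|ne]; first exact: hmu.
by apply: init_gt hmu => //; have := min mu muA; lia.
Qed.

(** If z_k has lowest part y_k, then A(z) has lowest part A'(y) for some
    nonzero A', and A'(y) is not zero as the y_k are algebraically
    independent. *)
Lemma subst_inj (w : 'I_m -> int) z A : char0 K ->
  (forall k, init (@wder K m w) (w k) (z k) (yvar K k)) -> subst z A = 0 -> A = 0.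
Proof.
move=> cK h zA; apply/eqP/negPn/negP => /(subst_init h)[A' [n [A'0]]].
rewrite zA subst_yvar => h0; have dw := wder_derivation K w.
have h0' : init (@wder K m w) n 0 0.
  by apply: span_init_eigen; apply: span0.
have := init_fun dw (torus_char0 (m := m) cK) h0 h0' => /eqP.
by rewrite tofrac_eq0; apply/negP.
Qed.

Definition zmonom z (a : 'rV[int]_m) : torus_field K m := \prod_(k < m) z k ^ a 0 k.

Lemma zmonom_split (a : 'rV[int]_m) : exists mu nu : 'X_{1..m}, forall z, (forall k, z k != 0) ->
    zmonom z a * subst z 'X_[nu] = subst z 'X_[mu].
Proof.
exists [multinom (if (0 <= a 0 i)%R then `|a 0%R i|%N else 0%N) | i < m].
exists [multinom (if (0 <= a 0 i)%R then 0%N else `|a 0%R i|%N) | i < m].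
move=> z z0; rewrite !substX -big_split; apply: eq_bigr => i _ /=.
rewrite !mnmE; case: (a 0 i) => n /=; first by rewrite expr0 mulr1.
by rewrite NegzE -exprnN expr0 mulVf // expf_neq0.
Qed.

(** Clearing denominators in a Laurent polynomial f, by the same monomial for
    the variables y and for the values z.  When z and y agree on the monomials
    of f, the numerator B computes f times that monomial in both cases. *)
Lemma span_clear (P : pred 'rV[int]_m) z f : (forall k, z k != 0) ->
  (forall a, P a -> zmonom z a = ymonom K a) -> span_monoms P f ->
  exists B nu, tofrac B = f * tofrac 'X_[nu] /\ subst z B = f * subst z 'X_[nu].
Proof.
move=> z0 zP; elim/span_ind => [|c a g Pa [B [nu [e1 e2]]]].
  by exists 0, 0%MM; rewrite !mul0r tofrac0; split=> //; apply: rmorph0.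
have [mu' [nu' E]] := zmonom_split a.
exists ('X_[nu'] * B + c *: ('X_[mu'] * 'X_[nu])), (nu' + nu)%MM.
have step x : (forall k, x k != 0) -> zmonom x a = ymonom K a ->
    subst x B = g * subst x 'X_[nu] ->
    subst x ('X_[nu'] * B + c *: ('X_[mu'] * 'X_[nu]))
    = (cst m c * ymonom K a + g) * subst x 'X_[nu' + nu].
  move=> x0 ea eB; rewrite mpolyXD substD substZ !substM eB -(E x x0) ea.
  by ring.
split; last by apply: step; rewrite ?zP.
by have := step (yvar K) (@yvar_neq0 K m) erefl; rewrite !subst_yvar; apply.
Qed.

Lemma tofrac_coord_ring A : coord_ring (tofrac A).
Proof.
rewrite -subst_yvar substE; apply: span_sum => mu _.
have -> : \prod_i yvar K i ^+ mu i = ymonom K (\row_i (mu i)%:Z).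
  by apply: eq_bigr => i _; rewrite mxE.
exact: span_term.
Qed.

Lemma coord_ringV A nu : coord_ring (tofrac A / tofrac 'X_[nu]).
Proof.
have -> : tofrac 'X_[nu] = ymonom K (\row_i (nu i)%:Z).
  by rewrite -subst_yvar substX; apply: eq_bigr => i _; rewrite mxE.
rewrite -ymonomN; apply: spanMmonom (tofrac_coord_ring A); exact.
Qed.

End Substitution.

(** * The bracket on homogeneous parts and on a ray *)

Section Bracket.
Variables (K : fieldType) (m : nat) (Omega : 'rV[int]_m -> 'rV[int]_m -> K).
Hypothesis char0K : char0 K.
Hypothesis OmegaB : skew_bicharacter Omega.

Lemma additive_int (f : 'rV[int]_m -> K) x a :
  (forall u v, f (u + v) = f u + f v) -> f (x *: a) = x%:~R * f a.
Proof.
move=> fD.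
have f0 : f 0 = 0 by apply: (addrI (f 0)); rewrite -fD !addr0.
have fN u : f (- u) = - f u by apply/eqP; rewrite -addr_eq0 -fD addNr f0.
have fn n : f (n%:Z *: a) = n%:R * f a.
  elim: n => [|n IHn]; first by rewrite scale0r f0 mul0r.
  by rewrite intS scalerDl scale1r fD IHn mulrS mulrDl mul1r.
case: x => n; first by rewrite fn.
by rewrite NegzE scaleNr fN fn mulrNz mulNr.
Qed.

Lemma additive_delta (f : 'rV[int]_m -> K) a :
  (forall u v, f (u + v) = f u + f v) ->
  f a = \sum_(k < m) (a 0 k)%:~R * f (delta_mx 0 k).
Proof.
move=> fD; have f0 : f 0 = 0 by apply: (addrI (f 0)); rewrite -fD !addr0.
rewrite {1}[a]row_sum_delta (big_morph f fD f0); apply: eq_bigr => k _.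
exact: additive_int.
Qed.

Lemma bicharZr x a b : Omega a (x *: b) = x%:~R * Omega a b.
Proof. by apply: additive_int => u v; rewrite (bichar_addr OmegaB). Qed.

Lemma bicharZl x a b : Omega (x *: a) b = x%:~R * Omega a b.
Proof. by apply: (@additive_int (Omega^~ b)) => u v; rewrite (bichar_addl OmegaB). Qed.

Lemma bichar_diag a : Omega a a = 0.
Proof.
have h : 2%:~R * Omega a a = 0.
  by rewrite (_ : 2%:~R = 1 + 1) // mulrDl mul1r {2}(bichar_skew OmegaB) subrr.
move/eqP: h; rewrite mulf_eq0 => /orP[/eqP/char0K//|/eqP//].
Qed.

Definition radical : pred 'rV[int]_m :=
  fun a => [forall k, Omega a (delta_mx 0 k) == 0].

Lemma radicalP a : reflect (forall b, Omega a b = 0) (radical a).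
Proof.
apply: (iffP forallP) => [h b|h k]; last by rewrite h.
rewrite (additive_delta _ (bichar_addr OmegaB a)) big1 // => k _.
by rewrite (eqP (h k)) mulr0.
Qed.

Lemma radical_saturated : saturated radical.
Proof.
split=> [|a b x y /radicalP ha /radicalP hb|x a x0 /radicalP h]; apply/radicalP => c.
- by rewrite -(scale0r 0) bicharZl mul0r.
- by rewrite (bichar_addl OmegaB) !bicharZl ha hb !mulr0 addr0.
have /eqP := h c; rewrite bicharZl mulf_eq0 => /orP[/eqP/char0K xx|/eqP//].
by rewrite xx eqxx in x0.
Qed.

Variable br : torus_field K m -> torus_field K m -> torus_field K m.
Hypothesis brO : omega_bracket Omega br.
Implicit Types (P Q R : pred 'rV[int]_m) (f g : torus_field K m).

Lemma br_derivation f : derivation (br f).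
Proof. by have [] := pb_derivation f (proj1 brO). Qed.

Lemma br_skew f g : br f g = - br g f.
Proof. exact: (pb_skew (proj1 brO)). Qed.

Lemma brDl f f' g : br (f + f') g = br f g + br f' g.
Proof. by rewrite !(br_skew _ g) (der_add (br_derivation g)) opprD. Qed.

Lemma br0l f : br 0 f = 0.
Proof. by rewrite br_skew (der0 (br_derivation f)) oppr0. Qed.

Lemma br_cstM f c g : br f (cst m c * g) = cst m c * br f g.
Proof.
have [_ bc] := pb_derivation f (proj1 brO).
exact: der_cstM (br_derivation f) (bc c).
Qed.

Lemma br_cstMl f c g : br (cst m c * f) g = cst m c * br f g.
Proof. by rewrite !(br_skew _ g) br_cstM mulrN. Qed.

Lemma span_br P Q R c f g : (forall a b, P a -> Q b -> R (a + b)) ->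
  span_monoms P f -> span_monoms Q g ->
  span_monoms R (br f g - cst m c * (f * g)).
Proof.
move=> PQR sf sg; elim/span_ind: f / sf => [|e a f Pa IH].
  by rewrite br0l !mul0r mulr0 subr0; apply: span0.
have -> : br (cst m e * ymonom K a + f) g - cst m c * ((cst m e * ymonom K a + f) * g)
  = cst m e * (br (ymonom K a) g - cst m c * (ymonom K a * g))
    + (br f g - cst m c * (f * g)).
  by rewrite brDl br_cstMl; ring.
apply: spanD => //; apply: spanZ; elim/span_ind: g / sg {IH} => [|e' b g Qb IH].
  by rewrite (der0 (br_derivation _)) !mulr0 subr0; apply: span0.
have -> : br (ymonom K a) (cst m e' * ymonom K b + g)
    - cst m c * (ymonom K a * (cst m e' * ymonom K b + g))
  = cst m ((Omega a b - c) * e') * ymonom K (a + b)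
    + (br (ymonom K a) g - cst m c * (ymonom K a * g)).
  rewrite (der_add (br_derivation _)) br_cstM (proj2 brO) ymonomD.
  by rewrite cstM cstD cstN; ring.
by apply: spanD => //; apply: span_term; apply: PQR.
Qed.

Lemma br_radical_eq0 f g : span_monoms radical f -> coord_ring g -> br f g = 0.
Proof.
move=> sf sg; elim/span_ind: f / sf => [|e a f /radicalP Ra IH]; first exact: br0l.
rewrite brDl br_cstMl IH addr0.
have -> : br (ymonom K a) g = 0; last by rewrite mulr0.
elim/span_ind: g / sg {IH} => [|e' b g _ IH]; first by rewrite (der0 (br_derivation _)).
rewrite (der_add (br_derivation _)) br_cstM (proj2 brO) Ra cst0 IH.
by rewrite !mul0r mulr0 addr0.
Qed.

(** The expression br f g - c f g is bilinear and adds weights, so the only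
    contribution of weight a + b to its value at f + f' and g + g', which is
    zero, comes from f and g. *)
Lemma br_lowest (w : 'I_m -> int) a b c f f' g g' :
  span_monoms (fun t => mdegree w t == a) f ->
  span_monoms (fun t => a < mdegree w t) f' ->
  span_monoms (fun t => mdegree w t == b) g ->
  span_monoms (fun t => b < mdegree w t) g' ->
  br (f + f') (g + g') = cst m c * ((f + f') * (g + g')) ->
  br f g = cst m c * (f * g).
Proof.
move=> sf sf' sg sg' e; have dw := wder_derivation K w.
pose T x y := br x y - cst m c * (x * y).
have T0 : T f g + (T f g' + (T f' g + T f' g')) = 0.
  rewrite -[RHS](subrr (br (f + f') (g + g'))) {2}e /T.
  by rewrite !(brDl, der_add (br_derivation _)); ring.
have h1 : init (@wder K m w) (a + b) (T f g) (T f g).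
  apply: span_init_eigen; apply: span_br sf sg => t u /eqP <- /eqP <-.
  by rewrite mdegreeD.
have h2 x y (X Y : pred int) :
    span_monoms (fun t => X (mdegree w t)) x -> span_monoms (fun t => Y (mdegree w t)) y ->
    (forall i j, X i -> Y j -> a + b < i + j) ->
    init (@wder K m w) (a + b) (T x y) 0.
  move=> sx sy XY; apply: span_init_gt; apply: span_br sx sy => t u Xt Yu.
  by rewrite mdegreeD; apply: XY.
have h3 : init (@wder K m w) (a + b) (T f g') 0.
  by apply: (h2 f g' (pred1 a) (fun i => b < i) sf sg') => i j /= /eqP ->; lia.
have h4 : init (@wder K m w) (a + b) (T f' g) 0.
  by apply: (h2 f' g (fun i => a < i) (pred1 b) sf' sg) => i j /= ? /eqP ->; lia.
have h5 : init (@wder K m w) (a + b) (T f' g') 0.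
  by apply: (h2 f' g' (fun i => a < i) (fun i => b < i) sf' sg') => i j /=; lia.
have := initD dw h1 (initD dw h3 (initD dw h4 h5)).
rewrite T0 !addr0 => h.
have h0 : init (@wder K m w) (a + b) 0 0 by apply: span_init_eigen; apply: span0.
have := init_fun dw (torus_char0 (m := m) char0K) h h0 => /eqP.
by rewrite subr_eq0 => /eqP.
Qed.

Section Ray.
Variables (d : 'I_m -> int) (s0 : 'rV[int]_m).
Hypothesis d0 : 0 < mdegree d s0.

Definition ray : pred 'rV[int]_m := fun t => mdegree d s0 *: t == mdegree d t *: s0.

Lemma degF_neq0 : (mdegree d s0)%:~R != 0 :> K.
Proof. by apply/eqP => /char0K e; have := d0; rewrite e ltxx. Qed.

(** The bracket of y^b with y^t, for t on the ray, is slope(b) deg(t) y^b y^t. *)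
Definition slope b : K := Omega b s0 / (mdegree d s0)%:~R.

Lemma Omega_ray b t : ray t -> Omega b t = slope b * (mdegree d t)%:~R.
Proof.
move=> /eqP e; have := congr1 (Omega b) e; rewrite !bicharZr => e'.
apply: (mulfI degF_neq0); rewrite e' /slope; field; exact: degF_neq0.
Qed.

Lemma slope_ray t : ray t -> slope t = 0.
Proof.
move=> rt; rewrite /slope (bichar_skew OmegaB) (Omega_ray _ rt) /slope.
by rewrite bichar_diag !mul0r oppr0 mul0r.
Qed.

Lemma br_monom_ray b f : span_monoms ray f ->
  br (ymonom K b) f = cst m (slope b) * ymonom K b * wder d f.
Proof.
have dd := wder_derivation K d.
elim/span_ind => [|c t g rt IH].
  by rewrite (der0 (br_derivation _)) (der0 dd) mulr0.
rewrite (der_add (br_derivation _)) br_cstM (proj2 brO) IH (der_add dd).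
by rewrite wder_cstM wder_monom (Omega_ray _ rt) cstM cst_int; ring.
Qed.

Lemma br_ray f g : span_monoms ray f -> span_monoms ray g -> br f g = 0.
Proof.
move=> sf sg; elim/span_ind: f / sf => [|c t f rt IH]; first exact: br0l.
by rewrite brDl br_cstMl br_monom_ray // slope_ray // cst0 IH !mul0r mulr0 addr0.
Qed.

(** Along a ray, bracketing with y^b is slope(b) y^b times the Euler
    derivation, and elements of the ray commute; the Leibniz rule turns the
    hypothesis into a relation between logarithmic derivatives. *)
Lemma log_der_ray a b p q : span_monoms ray p -> span_monoms ray q ->
  br (ymonom K a * p) (ymonom K b * q)
    = cst m (Omega a b) * (ymonom K a * p * (ymonom K b * q)) ->
  cst m (slope a) * p * wder d q = cst m (slope b) * q * wder d p.
Proof.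
move=> sp sq.
have lz x y z : br x (y * z) = br x y * z + y * br x z := der_mul (br_derivation x) y z.
rewrite lz !(br_skew (ymonom K a * p)) !lz.
rewrite !(br_skew _ (ymonom K a)) !(br_skew _ p).
rewrite (br_skew p (ymonom K b)) (br_ray sp sq) (proj2 brO).
rewrite !br_monom_ray // => e.
have a0 := ymonom_neq0 K a; have b0 := ymonom_neq0 K b.
apply: (mulfI a0); apply: (mulfI b0); apply/eqP; rewrite -subr_eq0.
move/eqP: e; rewrite -subr_eq0 => /eqP e; apply/eqP; rewrite -[RHS]e.
by ring.
Qed.

End Ray.
End Bracket.

(** * The part of the automorphism along an extremal ray *)

Lemma init_neq0 (K : fieldType) m (w : 'I_m -> int) n f g : char0 K ->
  g != 0 -> init (@wder K m w) n f g -> f != 0.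
Proof.
move=> cK g0 h; apply: contra_neq g0 => f0; rewrite f0 in h.
apply: (init_fun (wder_derivation K w) (torus_char0 (m := m) cK) h).
by apply: span_init_eigen; apply: span0.
Qed.

Section RayPart.
Variables (K : fieldType) (m : nat) (Omega : 'rV[int]_m -> 'rV[int]_m -> K).
Hypothesis char0K : char0 K.
Hypothesis OmegaB : skew_bicharacter Omega.
Variable br : torus_field K m -> torus_field K m -> torus_field K m.
Hypothesis brO : omega_bracket Omega br.
Variables (d w : 'I_m -> int) (s0 : 'rV[int]_m).
Hypothesis d0 : 0 < mdegree d s0.
Hypothesis w0 : mdegree w s0 = 0.
Hypothesis s0R : ~~ radical Omega s0.

Variable phi : {rmorphism torus_field K m -> torus_field K m}.
Variable psi : torus_field K m -> torus_field K m.
Hypothesis phiP : poisson_automorphism br phi psi.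
Hypothesis psi_coord : forall k, coord_ring (psi (yvar K k)).

Variables p q : 'I_m -> torus_field K m.
Hypothesis phiE : forall k, phi (yvar K k) / yvar K k = p k + q k.
Hypothesis p_ray :
  forall k, span_monoms (fun t => ray d s0 t && (0 < mdegree d t)) (p k - 1).
Hypothesis q_gt : forall k, span_monoms (fun t => 0 < mdegree w t) (q k).

Let dd := wder_derivation K d.
Let dw := wder_derivation K w.
Let cF := torus_char0 (m := m) char0K.

Lemma ray_part_span k : span_monoms (ray d s0) (p k).
Proof.
have h1 : span_monoms (ray d s0) (cst m 1 * ymonom K 0).
  by apply: span_term; rewrite /ray scaler0 mdegree0 scale0r.
rewrite cst1 mul1r ymonom0 in h1; rewrite -[p k](subrK 1); apply: spanD h1.
by apply: span_sub (p_ray k) => t /andP[].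
Qed.

Lemma ray_weight0 t : ray d s0 t -> mdegree w t = 0.
Proof.
move=> /eqP e; have := congr1 (mdegree w) e; rewrite !mdegreeZ w0 mulr0 => /eqP.
by rewrite mulf_eq0 (gt_eqF d0) => /eqP.
Qed.

Lemma phi_yvar k : phi (yvar K k) = yvar K k * p k + yvar K k * q k.
Proof. by rewrite -mulrDr -phiE mulrC divfK // yvar_neq0. Qed.

Lemma lowest_span k : span_monoms (fun t => mdegree w t == w k) (yvar K k * p k).
Proof.
rewrite -monom_delta mulrC; apply: spanMmonom (ray_part_span k) => t /ray_weight0 e.
by rewrite mdegreeD e add0r mdegree_delta.
Qed.

Lemma higher_span k : span_monoms (fun t => w k < mdegree w t) (yvar K k * q k).
Proof.
rewrite -monom_delta mulrC; apply: spanMmonom (q_gt k) => t t0.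
by rewrite mdegreeD mdegree_delta ltrDr.
Qed.

Lemma init_phi_yvar k :
  init (@wder K m w) (w k) (phi (yvar K k)) (yvar K k * p k).
Proof.
rewrite phi_yvar -[X in init _ _ _ X]addr0; apply: initD => //.
  exact: span_init_eigen (lowest_span k).
exact: span_init_gt (higher_span k).
Qed.

Lemma init_ray_part k : init (@wder K m d) 0 (p k) 1.
Proof.
rewrite -[p k](subrK 1) -[X in init _ _ _ X]add0r; apply: initD => //.
  by apply: span_init_gt; apply: span_sub (p_ray k) => t /andP[].
exact: init1.
Qed.

Lemma ray_part_neq0 k : p k != 0.
Proof. exact: init_neq0 char0K (oner_neq0 _) (init_ray_part k). Qed.

(** The lowest part, for the weight w, of the relation that phi preserves
    between y_k and y_l. *)
Lemma slope_relation k l :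
  cst m (slope Omega d s0 (delta_mx 0 k)) * p k * wder d (p l)
  = cst m (slope Omega d s0 (delta_mx 0 l)) * p l * wder d (p k).
Proof.
apply: (log_der_ray char0K OmegaB brO d0 (ray_part_span k) (ray_part_span l)).
rewrite !monom_delta.
apply: (br_lowest char0K brO (lowest_span k) (higher_span k)
          (lowest_span l) (higher_span l)).
rewrite -!phi_yvar -(pa_bracket phiP) -!monom_delta (proj2 brO) !rmorphM /=.
by rewrite (pa_cst phiP) mulrA.
Qed.

Lemma exists_slope : exists k, slope Omega d s0 (delta_mx 0 k) != 0.
Proof.
move: s0R; rewrite negb_forall => /existsP[k hk]; exists k.
rewrite mulf_neq0 ?invr_eq0 ?(degF_neq0 char0K d0) //.
by rewrite (bichar_skew OmegaB) oppr_eq0.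
Qed.

(** Multiplied by a nonzero slope(e_k), the logarithmic derivative of the
    product becomes that of p_k times the sum of the t_j slope(e_j), which is
    slope(t) = 0 since Omega is alternating.  So the product has degree 0, and
    its lowest part is 1. *)
Lemma ray_monom_fixed t : ray d s0 t -> \prod_(j < m) p j ^ t 0 j = 1.
Proof.
move=> rt; have [k k0] := exists_slope.
set P := \prod_(j < m) _.
have h1 : init (@wder K m d) 0 P 1.
  have := init_prod (index_enum 'I_m) dd
    (fun j => init_expz (t 0 j) dd cF (oner_neq0 _) (init_ray_part j)).
  rewrite big1 => [|j _]; last by rewrite mul0r.
  by rewrite [X in init _ _ _ X]big1 // => j _; rewrite exp1rz.
apply: (init_fun dd cF _ h1); apply: init_eigen => //; rewrite mul0r.
rewrite (der_prod _ dd ray_part_neq0); apply/eqP; rewrite mulf_eq0; apply/orP; right.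
have c0 : cst m (slope Omega d s0 (delta_mx 0 k)) != 0 by rewrite cst_eq0.
apply/eqP; apply: (mulfI c0); rewrite mulr0 mulr_sumr.
have E j : cst m (slope Omega d s0 (delta_mx 0 k)) * (wder d (p j) / p j)
         = cst m (slope Omega d s0 (delta_mx 0 j)) * (wder d (p k) / p k).
  apply/eqP; rewrite !mulrA eqr_div ?ray_part_neq0 // mulrAC slope_relation.
  by rewrite mulrAC.
rewrite (eq_bigr (fun j => cst m ((t 0 j)%:~R * slope Omega d s0 (delta_mx 0 j))
                           * (wder d (p k) / p k))) => [|j _]; last first.
  by rewrite mulrCA E mulrA (cstM m (t 0 j)%:~R) cst_int.
rewrite -mulr_suml -cst_sum -(additive_delta (f := slope Omega d s0)).
  by rewrite (slope_ray char0K OmegaB d0 rt) cst0 mul0r.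
by move=> u v; rewrite /slope (bichar_addl OmegaB) mulrDl.
Qed.

Let z k := yvar K k * p k.

Lemma z_neq0 k : z k != 0.
Proof. by rewrite mulf_neq0 ?yvar_neq0 ?ray_part_neq0. Qed.

Lemma zmonom_ray t : ray d s0 t -> zmonom z t = ymonom K t.
Proof.
move=> rt; rewrite -[RHS]mulr1 -(ray_monom_fixed rt) /zmonom /ymonom -big_split.
by apply: eq_bigr => j _ /=; rewrite expfzMl.
Qed.

Lemma subst_z_inj A : subst z A = 0 -> A = 0.
Proof.
apply: (subst_inj (w := d) char0K) => k.
rewrite -[X in init _ _ _ X]mulr1 -[d k]addr0; apply: initM (init_ray_part k) => //.
by apply: init_eigen => //; rewrite -monom_delta wder_monom mdegree_delta.
Qed.

(** The polynomials B and B' are a numerator of psi(y_k) and its part of least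
    w-weight; comparing the lowest parts of both sides of phi(psi(y_k)) = y_k
    gives p_k B'(z) = z_k z^nu.  With the numerator C of p_k, whose monomials
    are fixed by y -> z, this becomes an identity between values at z, which
    holds for y as well because the substitution is injective. *)
Lemma ray_part_eq1 k : p k = 1.
Proof.
have [B [nu [eB _]]] := span_clear (@yvar_neq0 K m) (fun _ _ => erefl) (psi_coord k).
have y0 := yvar_neq0 K k.
have ephi := pa_cancelV phiP (yvar K k).
have psi0 : psi (yvar K k) != 0.
  by apply: contra_neq y0 => e; rewrite -ephi e rmorph0.
have X0 mu : tofrac 'X_[mu] != 0 :> torus_field K m.
  by rewrite -subst_yvar; apply: subst_neq0; apply: yvar_neq0.
have B0 : B != 0 by rewrite -(tofrac_eq0 B) eB; exact: mulf_neq0 psi0 (X0 nu).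
have [B' [n [B'0 hB']]] := subst_init init_phi_yvar B0.
have B'z : subst z B' != 0 by apply: contra_neq B'0; apply: subst_z_inj.
have [_ eB'] : n = w k + \sum_(i < m) w i * (nu i)%:Z
            /\ subst z B' = yvar K k * subst z 'X_[nu].
  apply: (init_inj dw cF B'z _ hB').
    exact: mulf_neq0 y0 (subst_neq0 nu z_neq0).
  rewrite -(subst_morph _ (pa_cst phiP)) eB rmorphM /= ephi.
  apply: initM => //.
    by apply: init_eigen => //; rewrite -monom_delta wder_monom mdegree_delta.
  rewrite (subst_morph _ (pa_cst phiP)) !substX; apply: init_prod => // i.
  by apply: initX => //; apply: init_phi_yvar.
have [C [ga [eC ezC]]] := span_clear z_neq0 zmonom_ray (ray_part_span k).
have eCB : C * B' = 'X_[U_(k) + nu + ga].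
  apply/eqP; rewrite -subr_eq0; apply/eqP; apply: subst_z_inj.
  rewrite /subst rmorphB /= -!/(subst z _) substM ezC eB' !mpolyXD !substM.
  rewrite (_ : subst z 'X_k = z k); last by rewrite /subst mmapX mmap1U.
  by rewrite /z; ring.
have epB : p k * tofrac B' = tofrac 'X_[U_(k) + nu].
  apply: (mulIf (X0 ga)); rewrite mulrAC -eC -!tofracM eCB.
  by rewrite (mpolyXD _ (U_(k) + nu)).
apply: (unit_eq1 (d := d) (h := tofrac B' / tofrac 'X_[U_(k) + nu]) char0K).
- by apply: span_sub (p_ray k) => t /andP[].
- exact: coord_ringV.
rewrite mulrA epB; exact: divff (X0 _).
Qed.

End RayPart.

(** * Shrinking the supports into the radical *)

(** Each step removes from S all exponents on one extremal ray outside the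
    radical, since the corresponding parts of the u_k vanish. *)
Lemma support_in_radical (K : fieldType) m (Omega : 'rV[int]_m -> 'rV[int]_m -> K)
    (br : torus_field K m -> torus_field K m -> torus_field K m) (d : 'I_m -> int)
    (phi : {rmorphism torus_field K m -> torus_field K m})
    (psi : torus_field K m -> torus_field K m) (S : seq 'rV[int]_m) :
  char0 K -> skew_bicharacter Omega -> omega_bracket Omega br ->
  poisson_automorphism br phi psi -> (forall k, coord_ring (psi (yvar K k))) ->
  (forall s, s \in S -> 0 < mdegree d s) ->
  (forall k, span_monoms (mem S) (phi (yvar K k) / yvar K k - 1)) ->
  forall k, span_monoms (radical Omega) (phi (yvar K k) / yvar K k - 1).
Proof.
move=> cK OmegaB brO phiP psiC.
move: {2}(size S) (leqnn (size S)) => N.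
elim: N S => [|N IH] S sN dS uS k.
  apply: span_sub (uS k) => t /=.
  by move: sN; rewrite leqn0 => /nilP->; rewrite in_nil.
have [SR|/allPn[s sS sR]] := boolP (all (radical Omega) S).
  by apply: span_sub (uS k) => t; apply: (allP SR).
have [s0 [w [s0S s0R w0 w_ge0 w_ray]]] :=
  extremal_ray (radical_saturated cK OmegaB) dS sS sR.
have d0 := dS s0 s0S.
have /fin_all_exists[f /all_and2[f_ray f_gt]] : forall j, exists g,
    span_monoms (fun t => (t \in S) && ray d s0 t) g /\
    span_monoms (fun t => (t \in S) && ~~ ray d s0 t) (phi (yvar K j) / yvar K j - 1 - g).
  move=> j; have [g [h [-> hg hh]]] := span_split (ray d s0) (uS j).
  by exists g; rewrite [g + h]addrC addrK.
have f0 j : 1 + f j = 1.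
  apply: (@ray_part_eq1 _ _ _ cK OmegaB _ brO d w s0 d0 w0 s0R phi psi phiP psiC
    (fun j => 1 + f j) (fun j => phi (yvar K j) / yvar K j - 1 - f j)) => i.
  - by ring.
  - rewrite addrAC subrr add0r.
    by apply: span_sub (f_ray i) => t /andP[/dS -> ->].
  - apply: span_sub (f_gt i) => t /andP[tS]; apply: contraR => wt.
    by apply/eqP/w_ray => //; have := w_ge0 t tS; lia.
apply: (IH [seq t <- S | ~~ ray d s0 t]) => [|t|j].
- rewrite size_filter -ltnS; apply: leq_trans sN.
  rewrite -(count_predC (ray d s0) S) -[X in (X < _)%N]add0n ltn_add2r -has_count.
  by apply/hasP; exists s0; rewrite /ray ?eqxx.
- by rewrite mem_filter => /andP[_ /dS].
have fj : f j = 0 by apply: (addrI 1); rewrite f0 addr0.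
rewrite -[_ - 1]subr0 -fj; apply: span_sub (f_gt j) => t.
by rewrite inE mem_filter andbC.
Qed.

Lemma graded_gt_span (K : fieldType) m (d : 'I_m -> int) n (f : torus_field K m) :
  graded_gt d n f -> span_monoms (fun a => n < mdegree d a) f.
Proof.
move=> [s [g [hg ->]]]; apply: span_sum => l /hg[nl].
by apply: span_sub => a /eqP->.
Qed.

Lemma span_finite_support (K : fieldType) m P (f : torus_field K m) :
  span_monoms P f -> exists S : seq 'rV[int]_m, all P S /\ span_monoms (mem S) f.
Proof.
move=> [s Ps ->]; exists [seq t.2 | t <- s]; rewrite all_map; split => //.
by exists s => //; apply/allP => t ts; apply: map_f.
Qed.

Theorem theorem2p3 (K : fieldType) (charK : [pchar K] =i pred0)
    (m : nat) (m_gt0 : (0 < m)%N)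
    (d : 'I_m -> int) (d_gt0 : forall k, 0 < d k)
    (Omega : 'rV[int]_m -> 'rV[int]_m -> K)
    (Omega_bichar : skew_bicharacter Omega)
    (br : torus_field K m -> torus_field K m -> torus_field K m)
    (br_Omega : omega_bracket Omega br)
    (phi : {rmorphism torus_field K m -> torus_field K m})
    (psi : torus_field K m -> torus_field K m)
    (phi_poisson : poisson_automorphism br phi psi)
    (phi_bi_integral : bi_integral phi psi)
    (phi_unipotent : unipotent d phi) :
  forall k : 'I_m, poisson_center br (phi (yvar K k) / yvar K k).
Proof.
have cK := pchar0_char0 charK.
pose u k := phi (yvar K k) / yvar K k.
have u_gt k : span_monoms (fun a => 0 < mdegree d a) (u k - 1).
  have -> : u k - 1 = (phi (yvar K k) - yvar K k) * ymonom K (- delta_mx 0 k).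
    by rewrite ymonomN monom_delta mulrBl divff ?yvar_neq0.
  apply: spanMmonom (graded_gt_span (phi_unipotent k)) => a da.
  by rewrite mdegreeB mdegree_delta subr_gt0.
have /fin_all_exists[S /all_and2[S_gt uS]] k := span_finite_support (u_gt k).
pose S' := flatten [seq S k | k <- enum 'I_m].
have u_rad : forall k, span_monoms (radical Omega) (u k - 1).
  apply: (support_in_radical (S := S') cK Omega_bichar br_Omega phi_poisson) => [k|s|k].
  - by have [] := phi_bi_integral k.
  - by move=> /flatten_mapP[k _ sk]; apply: (allP (S_gt k)).
  apply: span_sub (uS k) => s sk.
  by apply/flatten_mapP; exists k; rewrite ?mem_enum.
move=> k; have {}u_rad : span_monoms (radical Omega) (u k).
  rewrite -[u k](subrK 1); apply: spanD (u_rad k) _.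
  have h : span_monoms (radical Omega) (cst m 1 * ymonom K 0).
    by apply: span_term; have [] := radical_saturated cK Omega_bichar.
  by rewrite cst1 mul1r ymonom0 in h.
split; first by apply: span_sub u_rad.
by move=> f; apply: (br_radical_eq0 Omega_bichar br_Omega).
Qed.
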